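(* Let $(X,T)$ be a linearly recurrent minimal Cantor system given by a nested sequence of CKR partitions $(\mathcal P(n))_{n\ge 0}$ satisfying (KR1)–(KR6) and (LR), with associated matrices $(M(n))_{n\ge1}$, and let $\mu$ be its unique $T$-invariant probability measure. Let $\alpha\in\mathbb R$ and $\lambda=\exp(2i\pi\alpha)$. (1) $\lambda$ is an eigenvalue of $(X,T)$ with respect to $\mu$ if and only if $\sum_{n\ge2}|\!|\!|\alpha P(n)H(1)|\!|\!|^2<\infty$. (2) $\lambda$ is a continuous eigenvalue of $(X,T)$ if and only if $\sum_{n\ge2}|\!|\!|\alpha P(n)H(1)|\!|\!|<\infty$.
   Context: A minimal Cantor system $(X,T)$: $X$ is a Cantor space, $T:X\to X$ a homeomorphism all of whose orbits are dense. A clopen Kakutani–Rohlin (CKR) partition is a partition $\{T^{-j}B_k:1\le k\le C,\ 0\le j<h_k\}$ of $X$ with $B_k$ clopen and $h_k\ge1$ integers. Consider a sequence of CKR partitions $\mathcal P(n)=\{T^{-j}B_k(n):1\le k\le C(n),0\le j<h_k(n)\}$, $n\ge0$, with $\mathcal P(0)$ trivial ($C(0)=1$, $B_1(0)=X$, $h_1(0)=1$); roof $B(n)=\bigcup_kB_k(n)$, $k$-th tower $\mathcal T_k(n)=\bigcup_{0\le j<h_k(n)}T^{-j}B_k(n)$. Conditions: (KR1) $B(n+1)\subseteq B(n)$; (KR2) every atom of $\mathcal P(n+1)$ is contained in an atom of $\mathcal P(n)$; (KR3) $\bigcap_nB(n)$ is a single point; (KR4) the partitions together generate the topology of $X$;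 (KR5) for all $n\ge1$, $1\le k\le C(n-1)$, $1\le l\le C(n)$ there is $0\le j<h_l(n)$ with $T^{-j}B_l(n)\subseteq B_k(n-1)$; (KR6) $B(n)\subseteq B_1(n-1)$ for all $n\ge1$. The matrix $M(n)$ ($n\ge1$) is the $C(n)\times C(n-1)$ matrix with entries $m_{l,k}(n)=\#\{0\le j<h_l(n):T^{-j}B_l(n)\subseteq B_k(n-1)\}$. $H(n)=(h_1(n),\dots,h_{C(n)}(n))^T$, so $H(n)=M(n)H(n-1)$ and $H(1)=M(1)$. For $n>m\ge0$, $P(n,m)=M(n)M(n-1)\cdots M(m+1)$, $P(n)=P(n,1)$. (LR): there is $L$ with $h_l(n)\le L\,h_k(n-1)$ for all $n\ge1$, $l\le C(n)$, $k\le C(n-1)$. A minimal Cantor system is linearly recurrent if it admits such a sequence satisfying (KR1)–(KR6) and (LR); such systems are uniquely ergodic. For $x\in\mathbb R$, $|\!|\!|x|\!|\!|$ is the distance from $x$ to the nearest integer; for $V=(v_1,\dots,v_m)^T$, $|\!|\!|V|\!|\!|=\max_j|\!|\!|v_j|\!|\!|$. $\lambda$ is an eigenvalue w.r.t. $\mu$ if $f\circ T=\lambda f$ for some nonzero $f\in L^2(\mu)$; a continuous eigenvalue if such $f$ can be taken continuous. *)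

(* Defs.v *)
From HB Require Import structures.
From mathcomp Require Import all_boot all_order all_algebra.
From mathcomp Require Import all_classical all_reals all_analysis.
Import Order.TTheory GRing.Theory Num.Theory.
Import numFieldNormedType.Exports.
Local Open Scope classical_set_scope.
Local Open Scope ring_scope.

Definition dnint {R : realType} (x : R) : R :=
  Num.min (x - (Num.floor x)%:~R) ((Num.floor x + 1)%:~R - x).

Definition dnintv {R : realType} {m : nat} (V : 'cV[R]_m) : R :=
  \big[Num.max/0]_(j < m) dnint (V j ord0).

Section Dynamics.
Variables (X : ptopologicalType) (T Ti : X -> X).

Definition homeo_with_inverse : Prop :=
  [/\ continuous T, continuous Ti, cancel T Ti & cancel Ti T].

Definition two_sided_orbit (x : X) : set X :=
  [set y | exists n : nat, y = iter n T x \/ y = iter n Ti x].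

Definition minimal : Prop := forall x : X, closure (two_sided_orbit x) = [set: X].

Definition minimal_cantor_system : Prop :=
  [/\ cantor_like X, homeo_with_inverse & minimal].
End Dynamics.

Section KR.
Variables (X : ptopologicalType) (T : X -> X).
Variables (C : nat -> nat) (B : forall n, 'I_(C n) -> set X)
          (h : forall n, 'I_(C n) -> nat).

Definition Tinvj (j : nat) (A : set X) : set X := iter j T @^-1` A.

Definition roof (n : nat) : set X := \bigcup_(k in [set: 'I_(C n)]) B n k.

Definition is_atom (n : nat) (A : set X) : Prop :=
  exists (k : 'I_(C n)) (j : nat), (j < h n k)%N /\ A = Tinvj j (B n k).

Definition CKR_partition (n : nat) : Prop :=
  [/\ forall k : 'I_(C n), clopen (B n k) /\ B n k !=set0,
      forall k : 'I_(C n), (0 < h n k)%N,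
      forall x, exists (k : 'I_(C n)) (j : nat), (j < h n k)%N /\ Tinvj j (B n k) x &
      forall (k k' : 'I_(C n)) (j j' : nat) x, (j < h n k)%N -> (j' < h n k')%N ->
        Tinvj j (B n k) x -> Tinvj j' (B n k') x -> k = k' /\ j = j'].

Definition P0_trivial : Prop :=
  C 0 = 1%N /\ forall k : 'I_(C 0), B 0 k = [set: X] /\ h 0 k = 1%N.

Definition KR1 : Prop := forall n, roof n.+1 `<=` roof n.

Definition KR2 : Prop := forall n (A : set X), is_atom n.+1 A ->
  exists A' : set X, is_atom n A' /\ A `<=` A'.

Definition KR3 : Prop := exists x : X, \bigcap_(n in [set: nat]) roof n = [set x].

Definition KR4 : Prop := forall (U : set X) (x : X), open U -> U x ->
  exists (n : nat) (A : set X), [/\ is_atom n A, A x & A `<=` U].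

Definition KR5 : Prop := forall n, (1 <= n)%N ->
  forall (k : 'I_(C n.-1)) (l : 'I_(C n)),
    exists j : nat, (j < h n l)%N /\ Tinvj j (B n l) `<=` B n.-1 k.

(* B(n) is contained in the first base B_1(n-1) (index 0 here) *)
Definition KR6 : Prop := forall n, (1 <= n)%N ->
  forall k : 'I_(C n.-1), nat_of_ord k = 0%N -> roof n `<=` B n.-1 k.

Definition LR : Prop := exists L : nat, forall n, (1 <= n)%N ->
  forall (l : 'I_(C n)) (k : 'I_(C n.-1)), (h n l <= L * h n.-1 k)%N.

Definition KR_LR_sequence : Prop :=
  [/\ (forall n, CKR_partition n), P0_trivial, KR1, KR2 &
      [/\ KR3, KR4, KR5, KR6 & LR]].

Variable R : realType.

Definition Mmat (n : nat) : 'M[R]_(C n, C n.-1) :=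
  \matrix_(l, k) (#|[set j : 'I_(h n l) | `[< Tinvj j (B n l) `<=` B n.-1 k >] ]|)%:R.

(* Pm m = M(m+1) M(m) ... M(2) = P(m+1) *)
Fixpoint Pm (m : nat) : 'M[R]_(C m.+1, C 1) :=
  match m as m0 return 'M[R]_(C m0.+1, C 1) with
  | 0 => 1%:M
  | m'.+1 => Mmat m'.+2 *m Pm m'
  end.

Definition Pmat (n : nat) : 'M[R]_(C n.-1.+1, C 1) := Pm n.-1.

Definition H1 : 'cV[R]_(C 1) := \col_(i < C 1) (h 1 i)%:R.

End KR.

Section Eigen.
Variables (R : realType) (X : ptopologicalType) (T : X -> X).

Definition borelX := g_sigma_algebraType (@open X).

Definition T_invariant (mu : probability borelX R) : Prop :=
  forall A : set borelX, measurable A -> mu (T @^-1` A) = mu A.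

(* lambda = exp(2 i pi alpha) is an eigenvalue w.r.t. mu: there is a nonzero
   f = f1 + i f2 in L^2(mu) with f o T = lambda f  mu-a.e. *)
Definition L2_eigenvalue (mu : probability borelX R) (alpha : R) : Prop :=
  let c := cos (2 * pi * alpha) in let s := sin (2 * pi * alpha) in
  exists f1 f2 : borelX -> R,
    [/\ measurable_fun setT f1, measurable_fun setT f2,
        (\int[mu]_x ((f1 x) ^+ 2 + (f2 x) ^+ 2)%:E < +oo)%E,
        ~ {ae mu, forall x, f1 x = 0 /\ f2 x = 0} &
        {ae mu, forall x, f1 (T x) = c * f1 x - s * f2 x /\
                          f2 (T x) = s * f1 x + c * f2 x}].

Definition continuous_eigenvalue (alpha : R) : Prop :=
  let c := cos (2 * pi * alpha) in let s := sin (2 * pi * alpha) in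
  exists f1 f2 : X -> R,
    [/\ continuous f1, continuous f2,
        (exists x, f1 x != 0 \/ f2 x != 0) &
        forall x, f1 (T x) = c * f1 x - s * f2 x /\
                  f2 (T x) = s * f1 x + c * f2 x].
End Eigen.

(* Main.v *)
(* By induction P(n)H(1) = H(n), so both conditions are about d(n), the maximum
   over k of the distance of alpha h_k(n) to the integers. The entrance time
   r_n(x) of x into the roof B(n) satisfies: r_(n+1)(x) - r_n(x) is a sum of at
   most L heights of level n.

   Sufficiency. Let rho_n(x) be the sum over i < n of the signed residues of
   alpha (r_(i+1)(x) - r_i(x)), so that rho_n = alpha r_n modulo 1. If d is
   summable then rho_n converges uniformly to some rho and exp(-2 i pi rho) is a
   continuous eigenfunction. If d is square summable, the towers of x at
   successive levels form a Markov chain for which linear recurrence gives a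
   Doeblin condition, so the variance of rho_n - rho_m is O(sum_(m <= i < n) d(i)^2);
   after subtraction of constants a subsequence of rho_n converges almost
   everywhere.

   Necessity. Let f be an eigenfunction in L^2 and a_n(k) its mean over B_k(n).
   The conditional expectations of f given P(n) form a martingale bounded in L^2
   with value exp(-2 i pi alpha j) a_n(k) on T^-j B_k(n). Its increments are
   square summable, so a_n(k) is almost independent of k and
   exp(2 i pi alpha j) is close to 1, with square summable errors, whenever
   T^-j B_l(n+1) is contained in B_k(n); heights are differences of two such j. The
   exception is a tower at the bottom of the next one, which is dealt with one
   level up when C(n+1) > 1. If C(n) = 1 for some large n then B(n) is invariant
   under T^-h(n), which forces alpha h(n) to be an integer. If f is continuous,
   return times to B(n) are almost integers after multiplication by alpha; visits
   at every second level can be chosen freely, in particular with residues of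
   constant sign, so that the residues are summable. *)

Require Import Defs.
From HB Require Import structures.
From mathcomp Require Import all_boot all_order all_algebra.
From mathcomp Require Import all_classical all_reals all_analysis.
From mathcomp Require Import measurable_realfun.
From mathcomp Require Import ring lra zify.
Import Order.TTheory GRing.Theory Num.Theory.
Import numFieldNormedType.Exports.
Local Open Scope classical_set_scope.
Local Open Scope ring_scope.

(** * Distance to the nearest integer and its comparison with the cosine *)

Section DistanceToIntegers.
Context {R : realType}.
Implicit Types (x y : R) (m : int).

(** Ties round down, so [sres] takes values in []-1/2, 1/2]]. Its sign is kept because residues will
    be summed and must stay congruent to the original reals modulo 1. *)
Definition nearint x : int :=
  if x - (Num.floor x)%:~R <= (Num.floor x + 1)%:~R - x
  then Num.floor x else Num.floor x + 1.

Definition sres x : R := x - (nearint x)%:~R.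

Lemma norm_sres x : `|sres x| = dnint x.
Proof.
rewrite /sres /nearint /dnint.
have h1 : (Num.floor x)%:~R <= x := floor_le_tmp x.
have h2 : x < (Num.floor x + 1)%:~R := floorD1_gt x.
case: ifPn => hx.
  by rewrite (min_idPl hx) ger0_norm ?subr_ge0.
rewrite (min_idPr _); last by rewrite ltW // ltNge.
by rewrite distrC ger0_norm // subr_ge0 ltW.
Qed.

Lemma dnint_ge0 x : 0 <= dnint x.
Proof. by rewrite -norm_sres. Qed.

Lemma dnint_le_half x : dnint x <= 2^-1.
Proof.
by rewrite /dnint intrD /Num.min; case: ltP => ?; lra.
Qed.

(** Integers other than the two neighbours of [x] are farther away. Subadditivity, evenness and
    periodicity follow by choosing [m] among nearest integers. *)
Lemma dnint_le_dist x m : dnint x <= `|x - m%:~R|.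
Proof.
rewrite /dnint.
have h1 : (Num.floor x)%:~R <= x := floor_le_tmp x.
have h2 : x < (Num.floor x + 1)%:~R := floorD1_gt x.
rewrite ge_min; case: (lerP m (Num.floor x)) => hm.
  apply/orP; left; have hm' : m%:~R <= (Num.floor x)%:~R :> R by rewrite ler_int.
  by rewrite ger0_norm; lra.
apply/orP; right.
have hm' : (Num.floor x + 1)%:~R <= m%:~R :> R by rewrite ler_int; lia.
by rewrite distrC ger0_norm; lra.
Qed.

Lemma dnint_small y : `|y| <= 2^-1 -> dnint y = `|y|.
Proof.
move=> hy; apply/eqP; rewrite eq_le; apply/andP; split.
  by have := dnint_le_dist y 0; rewrite subr0.
rewrite -norm_sres /sres.
have [->|hn] := eqVneq (nearint y) 0; first by rewrite subr0.
have h1 : (1 : R) <= `|(nearint y)%:~R|.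
  by rewrite -intr_norm ler1z; lia.
rewrite distrC; have := lerB_normD (nearint y)%:~R (- y); rewrite normrN; lra.
Qed.

Lemma dnint0 : dnint (0 : R) = 0.
Proof. by rewrite dnint_small ?normr0 // invr_ge0. Qed.

Lemma dnintD x y : dnint (x + y) <= dnint x + dnint y.
Proof.
rewrite -(norm_sres x) -(norm_sres y); apply: le_trans (ler_normD _ _).
have := dnint_le_dist (x + y) (nearint x + nearint y); rewrite intrD.
by congr (_ <= `|_|); rewrite /sres; ring.
Qed.

Lemma dnintN x : dnint (- x) = dnint x.
Proof.
have h (z : R) : dnint (- z) <= dnint z.
  have := dnint_le_dist (- z) (- nearint z).
  by rewrite mulrNz -opprD normrN -/(sres z) norm_sres.
by apply/eqP; rewrite eq_le h -{1}(opprK x) h.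
Qed.

Lemma dnintDint x m : dnint (x + m%:~R) = dnint x.
Proof.
have h (z : R) (k : int) : dnint (z + k%:~R) <= dnint z.
  have := dnint_le_dist (z + k%:~R) (nearint z + k).
  by rewrite intrD opprD addrACA subrr addr0 -/(sres z) norm_sres.
by apply/eqP; rewrite eq_le h -{1}(addrK m%:~R x) -mulrNz h.
Qed.

Lemma dnintB x y : dnint (x - y) <= dnint x + dnint y.
Proof. by rewrite -(dnintN y) dnintD. Qed.

Lemma dnint_sres x : dnint (sres x) = dnint x.
Proof. by rewrite /sres -mulrNz dnintDint. Qed.

Lemma cos2piDint x m : cos (2 * pi * (x + m%:~R)) = cos (2 * pi * x).
Proof.
have hn (n : nat) (z : R) : cos (2 * pi * (z + n%:R)) = cos (2 * pi * z).
  elim: n z => [|n IH] z; first by rewrite addr0.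
  have -> : z + n.+1%:R = z + n%:R + 1 by rewrite -addrA natr1.
  rewrite -(IH z) mulrDr mulr1.
  have -> : 2 * pi = pi *+ 2 :> R by rewrite mulr_natl.
  by rewrite cosD2pi.
case: m => n; first by rewrite -pmulrn hn.
by rewrite NegzE mulrNz -pmulrn -[in RHS](subrK n.+1%:R x) hn.
Qed.

Lemma sin2piDint x m : sin (2 * pi * (x + m%:~R)) = sin (2 * pi * x).
Proof.
have hn (n : nat) (z : R) : sin (2 * pi * (z + n%:R)) = sin (2 * pi * z).
  elim: n z => [|n IH] z; first by rewrite addr0.
  have -> : z + n.+1%:R = z + n%:R + 1 by rewrite -addrA natr1.
  rewrite -(IH z) mulrDr mulr1.
  have -> : 2 * pi = pi *+ 2 :> R by rewrite mulr_natl.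
  by rewrite sinD2pi.
case: m => n; first by rewrite -pmulrn hn.
by rewrite NegzE mulrNz -pmulrn -[in RHS](subrK n.+1%:R x) hn.
Qed.

(** If [sin y < y / 2], the mean slope on [[0, y]] is below 1/2, hence also on [[y, pi / 2]] since
    the cosine decreases; then [sin (pi / 2)] would be less than [pi / 4 < 1]. *)
Lemma half_le_sin y : 0 <= y <= pi / 2 -> y / 2 <= sin y.
Proof.
have p4 : pi / 2 < 2 :> R := pihalf_lt2 R.
have p2 := pihalf_ge1 R.
have mvt (a b : R) : a < b -> exists2 c, c \in `]a, b[%R &
    sin b - sin a = cos c * (b - a).
  move=> ab; apply: MVT => //.
  by apply: continuous_subspaceT => z; exact: continuous_sin.
case/andP; rewrite le_eqVlt => /orP[/eqP <-|y0] y1; first by rewrite mul0r sin0.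
case: (lerP (y / 2) (sin y)) => // hlt; exfalso.
have [c] := mvt 0 y y0; rewrite in_itv /= sin0 !subr0 => /andP[c0 cy] hc.
have hcos : cos c < 2^-1 by rewrite hc in hlt; nra.
have yp : y < pi / 2.
  rewrite lt_neqAle y1 andbT; apply/eqP => e; move: hlt; rewrite e sin_pihalf; lra.
have [c'] := mvt y (pi / 2) yp; rewrite in_itv /= sin_pihalf => /andP[c'0 c'1] hc'.
have : cos c' < cos c.
  by rewrite ltr_cos ?in_itv /=; [lra|lra|lra].
nra.
Qed.

(** With [s] the modulus of the residue, [1 - cos (2 * pi * s) = 2 * sin (pi * s) ^+ 2] and
    [sin (pi * s) >= pi * s / 2 >= s]. This turns closeness of [exp (2 i pi x)] to 1 into closeness
    of [x] to an integer. *)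
Lemma dnint_le_cos x : 2 * dnint x ^+ 2 <= 1 - cos (2 * pi * x).
Proof.
have -> : cos (2 * pi * x) = cos (2 * pi * sres x).
  by rewrite /sres -mulrNz cos2piDint.
rewrite -dnint_sres -(cos_norm (2 * pi * _)) !normrM (ger0_norm (pi_ge0 R)) ger0_norm //.
have h := dnint_le_half x; rewrite -norm_sres in h.
rewrite dnint_small //; move: (normr_ge0 (sres x)) h; set s := `|_| => s0 s1.
have p2 := pi_ge2 R.
have h1 : pi * s / 2 <= sin (pi * s) by apply: half_le_sin; apply/andP; split; nra.
have -> : 2 * pi * s = pi * s *+ 2 by rewrite -mulrA mulr_natl.
rewrite cos_mulr2n cos2sin2.
have : s <= sin (pi * s) by apply: le_trans h1; nra.
rewrite -mulr_natl; nra.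
Qed.

End DistanceToIntegers.

(** * Convergence of nonnegative series as boundedness of partial sums *)

Section NonnegativeSeries.
Context {R : realType}.

Lemma nneseries_lt_pinftyP (u : nat -> R) (p : nat) : (forall n, 0 <= u n) ->
  (\sum_(p <= n <oo) (u n)%:E < +oo)%E <->
  exists K, forall N, \sum_(p <= n < N) u n <= K.
Proof.
move=> u0; split => [hfin|[K hK]].
  have hs0 : (0 <= \sum_(p <= n <oo) (u n)%:E)%E.
    by apply: nneseries_ge0 => n _ _; rewrite lee_fin.
  exists (fine (\sum_(p <= n <oo) (u n)%:E)%E) => N.
  rewrite -lee_fin fineK; last by rewrite ge0_fin_numE.
  rewrite -sumEFin; apply: nneseries_lim_ge => n _ _; by rewrite lee_fin.
apply: (@le_lt_trans _ _ K%:E); last exact: ltry.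
apply: lime_le.
  by apply: is_cvg_nneseries => n _ _; rewrite lee_fin.
by near=> N; rewrite sumEFin lee_fin.
Unshelve. all: by end_near. Qed.

End NonnegativeSeries.

(** * Return times to the roofs *)

(** Bundling the data with the hypotheses lets the objects chosen below depend on a single argument
    [S]. *)
Record kr_system (X : ptopologicalType) := KRSystem {
  sT : X -> X;
  sTi : X -> X;
  sC : nat -> nat;
  sB : forall n, 'I_(sC n) -> set X;
  sh : forall n, 'I_(sC n) -> nat;
  sys_minimal : minimal_cantor_system X sT sTi;
  sys_KR : KR_LR_sequence X sT sC sB sh }.

Arguments sT {X} _ _.
Arguments sTi {X} _ _.
Arguments sC {X} _ _.
Arguments sB {X} _ _ _ _.
Arguments sh {X} _ _ _.

Section TowerMap.
Context {X : ptopologicalType} (S : kr_system X).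
Local Notation T := (sT S).
Local Notation Ti := (sTi S).
Local Notation C := (sC S).
Local Notation B := (sB S).
Local Notation h := (sh S).

Lemma sys_partition n : CKR_partition X T C B h n.
Proof. by have [H _ _ _ _] := sys_KR _ S; exact: H. Qed.

Lemma location_ex n (x : X) : exists p : 'I_(C n) * nat,
  (p.2 < h n p.1)%N /\ B n p.1 (iter p.2 T x).
Proof.
have [_ _ H _] := sys_partition n.
by have [k [j [hj hx]]] := H x; exists (k, j).
Qed.

Definition tower n (x : X) : 'I_(C n) := (projT1 (cid (location_ex n x))).1.

(** Atoms are the sets [T^-j B_k], so bases are on top and [j] counts the steps up to the roof: this
    is the entrance time of [x] into it. *)
Definition ret n (x : X) : nat := (projT1 (cid (location_ex n x))).2.

Lemma sC_gt0 n : (0 < C n)%N.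
Proof. by apply: leq_ltn_trans (ltn_ord (tower n point)). Qed.

Definition first n : 'I_(C n) := Ordinal (sC_gt0 n).

Lemma sB_ex n (k : 'I_(C n)) : exists x : X, B n k x.
Proof.
have [H _ _ _] := sys_partition n; exact: (H k).2.
Qed.

(** A sample point of the floor [T^-j B_k]; it has this meaning only for [j < h n k]. *)
Definition pos n (k : 'I_(C n)) (j : nat) : X :=
  iter j Ti (projT1 (cid (sB_ex n k))).

Lemma LR_ex : exists L : nat, forall n (l : 'I_(C n.+1)) (k : 'I_(C n)),
  (h n.+1 l <= L * h n k)%N.
Proof.
have [_ _ _ _ [_ _ _ _ [L HL]]] := sys_KR _ S.
by exists L => n l k; exact: (HL n.+1 isT l k).
Qed.

Definition sL : nat := projT1 (cid LR_ex).

(** Inclusion of [T^-j B_l(n+1)] in [B_k(n)], tested on one sample point to obtain a boolean. By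
    (KR2) the answer does not depend on the point, see [occursP]. *)
Definition occurs n (l : 'I_(C n.+1)) (k : 'I_(C n)) (j : nat) : bool :=
  (tower n (pos n.+1 l j) == k) && (ret n (pos n.+1 l j) == 0%N).

End TowerMap.

Section TowerTheory.
Context {X : ptopologicalType} (S : kr_system X).
Local Notation T := (sT S).
Local Notation Ti := (sTi S).
Local Notation C := (sC S).
Local Notation B := (sB S).
Local Notation h := (sh S).
Local Notation tower := (tower S).
Local Notation ret := (ret S).
Local Notation pos := (pos S).
Local Notation first := (first S).
Local Notation L := (sL S).

Lemma sTK : cancel T Ti.
Proof. by have [_ [_ _ H _] _] := sys_minimal _ S. Qed.

Lemma sTiK : cancel Ti T.
Proof. by have [_ [_ _ _ H] _] := sys_minimal _ S. Qed.

Lemma iter_sTiK j x : iter j T (iter j Ti x) = x.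
Proof. by elim: j x => // j IH x; rewrite iterSr /= sTiK IH. Qed.

Lemma iter_sTiB i j x : (i <= j)%N -> iter i T (iter j Ti x) = iter (j - i) Ti x.
Proof. by move=> /subnKC <-; rewrite iterD iter_sTiK addKn. Qed.

Lemma h_gt0 n (k : 'I_(C n)) : (0 < h n k)%N.
Proof. by have [_ H _ _] := sys_partition S n. Qed.

Lemma le_sL n (l : 'I_(C n.+1)) (k : 'I_(C n)) : (h n.+1 l <= L * h n k)%N.
Proof. by rewrite /sL; case: cid. Qed.

Lemma sL_gt0 : (0 < L)%N.
Proof.
have := le_sL 0 (first 1) (first 0); have := h_gt0 1 (first 1).
by case: (L) => //; rewrite mul0n; lia.
Qed.

Lemma ret_lt n x : (ret n x < h n (tower n x))%N.
Proof. by rewrite /ret /tower; case: cid => p []. Qed.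

Lemma tower_mem n x : B n (tower n x) (iter (ret n x) T x).
Proof. by rewrite /ret /tower; case: cid => p []. Qed.

Lemma tower_uniq n (k : 'I_(C n)) j x : (j < h n k)%N -> B n k (iter j T x) ->
  tower n x = k /\ ret n x = j.
Proof.
move=> hj hB; have [_ _ _ H] := sys_partition S n.
exact: (H _ _ _ _ x (ret_lt n x) hj (tower_mem n x) hB).
Qed.

Lemma mem_tower n (k : 'I_(C n)) x : B n k x -> tower n x = k /\ ret n x = 0%N.
Proof. by move=> hB; apply: tower_uniq => //; exact: h_gt0. Qed.

Lemma ret0_mem n x : ret n x = 0%N -> B n (tower n x) x.
Proof. by move=> h0; have := tower_mem n x; rewrite h0. Qed.

Lemma roofP n x : roof X C B n x <-> ret n x = 0%N.
Proof.
split=> [[k _ /mem_tower[]]//|/ret0_mem hB]; by exists (tower n x).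
Qed.

Lemma ret_T n x : (0 < ret n x)%N ->
  tower n (T x) = tower n x /\ ret n (T x) = (ret n x).-1.
Proof.
move=> h0; apply: tower_uniq.
  by apply: leq_ltn_trans (leq_pred _) (ret_lt n x).
by rewrite -iterSr prednK //; exact: tower_mem.
Qed.

Lemma ret_iter n x i : (i <= ret n x)%N ->
  tower n (iter i T x) = tower n x /\ ret n (iter i T x) = (ret n x - i)%N.
Proof.
move=> hi; apply: tower_uniq.
  by apply: leq_ltn_trans (leq_subr _ _) (ret_lt n x).
by rewrite -iterD subnK //; exact: tower_mem.
Qed.

Lemma ret_le_visit n x i : ret n (iter i T x) = 0%N -> (ret n x <= i)%N.
Proof.
move=> h0; rewrite leqNgt; apply/negP => hi.
have [_] := ret_iter n x i (ltnW hi); rewrite h0; lia.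
Qed.

Lemma ret_first n x : ret n.+1 x = 0%N -> tower n x = first n /\ ret n x = 0%N.
Proof.
move=> h0; apply: mem_tower.
have [_ _ _ _ [_ _ _ H _]] := sys_KR _ S.
by apply: (H n.+1 isT (first n) erefl); apply/roofP.
Qed.

Lemma ret_leS n x : (ret n x <= ret n.+1 x)%N.
Proof.
apply: ret_le_visit; apply: (ret_first _ _ _).2.
by have [_ ->] := ret_iter n.+1 x _ (leqnn _); rewrite subnn.
Qed.

Lemma ret_le m n x : (m <= n)%N -> (ret m x <= ret n x)%N.
Proof.
move=> /subnK <-; elim: (n - m)%N => // i IH.
by rewrite addSn; apply: leq_trans IH (ret_leS _ _).
Qed.

(** This is (KR2) for points: the common atom of level [n.+1] lies in one atom of level [n]. *)
Lemma tower_coarsen n x y : tower n.+1 x = tower n.+1 y -> ret n.+1 x = ret n.+1 y ->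
  tower n x = tower n y /\ ret n x = ret n y.
Proof.
move=> ht hr; have [_ _ _ H _] := sys_KR _ S.
have [A' [[k [j [hj ->]]] hA]] := H n (Tinvj X T (ret n.+1 x) (B n.+1 (tower n.+1 x)))
  (ex_intro _ _ (ex_intro _ _ (conj (ret_lt _ _) erefl))).
have [-> ->] := tower_uniq n k j x hj (hA x (tower_mem _ _)).
suff [-> ->] : tower n y = k /\ ret n y = j by [].
by apply: tower_uniq => //; apply: hA; rewrite ht hr; exact: tower_mem.
Qed.

Lemma ret_split n x :
  [/\ tower n.+1 (iter (ret n x) T x) = tower n.+1 x,
      ret n.+1 x = (ret n.+1 (iter (ret n x) T x) + ret n x)%N,
      tower n (iter (ret n x) T x) = tower n x &
      ret n (iter (ret n x) T x) = 0%N].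
Proof.
have [h1 h2] := ret_iter n.+1 x _ (ret_leS n x).
have [h3 h4] := ret_iter n x _ (leqnn _).
by split => //; rewrite ?h2 ?subnK ?ret_leS // h4 subnn.
Qed.

Lemma visit_ex n (l : 'I_(C n.+1)) (k : 'I_(C n)) :
  exists y, [/\ tower n.+1 y = l, tower n y = k & ret n y = 0%N].
Proof.
have [_ _ _ _ [_ _ H _ _]] := sys_KR _ S.
have [j [hj hsub]] := H n.+1 isT k l.
have hy : B n.+1 l (iter j T (pos n.+1 l j)).
  by rewrite iter_sTiK; case: cid.
exists (pos n.+1 l j); split.
- by have [] := tower_uniq _ _ _ _ hj hy.
- by have [] := mem_tower n k _ (hsub _ hy).
- by have [] := mem_tower n k _ (hsub _ hy).
Qed.

Lemma tower_pos n (k : 'I_(C n)) j : (j < h n k)%N ->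
  tower n (pos n k j) = k /\ ret n (pos n k j) = j.
Proof. by move=> hj; apply: tower_uniq => //; rewrite iter_sTiK; case: cid. Qed.

Lemma tower_below n (k : 'I_(C n)) y i : (i < h n k)%N -> B n k y ->
  tower n (iter i Ti y) = k /\ ret n (iter i Ti y) = i.
Proof. by move=> hi hy; apply: tower_uniq => //; rewrite iter_sTiK. Qed.

Lemma tower_belowS n y i : ret n y = 0%N -> (i < h n (tower n y))%N ->
  [/\ tower n (iter i Ti y) = tower n y, ret n (iter i Ti y) = i,
      tower n.+1 (iter i Ti y) = tower n.+1 y &
      ret n.+1 (iter i Ti y) = (ret n.+1 y + i)%N].
Proof.
move=> h0 hi; have [h1 h2] := tower_below n _ y i hi (ret0_mem _ _ h0).
by have [] := ret_split n (iter i Ti y); rewrite h2 iter_sTiK => -> ->.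
Qed.

(** Read downwards, a tower of level [n.+1] is a concatenation of whole towers of level [n]: below
    the one hanging from [y] comes either the end of the big tower or the top of another one. *)
Lemma next_visit n y : ret n y = 0%N ->
  (ret n.+1 y + h n (tower n y))%N = h n.+1 (tower n.+1 y) \/
  exists y', [/\ tower n.+1 y' = tower n.+1 y,
    ret n.+1 y' = (ret n.+1 y + h n (tower n y))%N & ret n y' = 0%N].
Proof.
move=> h0; have hk := h_gt0 n (tower n y).
have hk' : ((h n (tower n y)).-1 < h n (tower n y))%N by rewrite prednK.
have [w1 w2 w3 w4] := tower_belowS n y _ h0 hk'.
have := ret_lt n.+1 (iter (h n (tower n y)).-1 Ti y); rewrite w3 w4 => hlt.
case: (ltnP (ret n.+1 y + h n (tower n y)) (h n.+1 (tower n.+1 y))) => hl; last by left; lia.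
right; exists (iter (h n (tower n y)) Ti y).
have [t1 t2] : tower n.+1 (iter (h n (tower n y)) Ti y) = tower n.+1 y /\
    ret n.+1 (iter (h n (tower n y)) Ti y) = (ret n.+1 y + h n (tower n y))%N.
  by apply: tower_uniq => //; rewrite iterD iter_sTiK; exact: tower_mem.
(* Outside the roof, this point would continue the tower of [y] to depth [h n (tower n y)], one more
   than allowed. *)
split => //; apply/eqP; rewrite -leqn0 leqNgt; apply/negP => hpos.
have eT : T (iter (h n (tower n y)) Ti y) = iter (h n (tower n y)).-1 Ti y.
  by rewrite -{1}(prednK hk) /= sTiK.
have [] := ret_T _ _ hpos; rewrite eT w1 w2 => e1 e2.
by have := ret_lt n (iter (h n (tower n y)) Ti y); rewrite -e1; lia.
Qed.

(** By (KR6) tower [first n.+2] begins, from the top, with a copy of [first n.+1]. Equal heights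
    would leave no room for the second tower of level [n.+1], which occurs in it by (KR5). *)
Lemma roof_first_ne n : (1 < C n.+1)%N -> h n.+2 (first n.+2) != h n.+1 (first n.+1).
Proof.
move=> hC; have [y [y1 y2 y3]] := visit_ex n.+1 (first n.+2) (Ordinal hC).
apply/eqP => heq.
have [t1 _] : tower n.+1 y = first n.+1 /\ ret n.+1 y = ret n.+2 y.
  apply: tower_uniq; first by rewrite -heq -y1 ret_lt.
  have hz : ret n.+2 (iter (ret n.+2 y) T y) = 0%N.
    by have [_ ->] := ret_iter n.+2 y _ (leqnn _); rewrite subnn.
  have [e1 e2] := ret_first _ _ hz; rewrite -e1; exact: ret0_mem.
by move: y2; rewrite t1 => /(congr1 val).
Qed.

Lemma occursP n (l : 'I_(C n.+1)) (k : 'I_(C n)) y : tower n.+1 y = l ->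
  occurs S n l k (ret n.+1 y) = (tower n y == k) && (ret n y == 0%N).
Proof.
move=> <-; rewrite /occurs.
have [h1 h2] := tower_pos n.+1 _ _ (ret_lt n.+1 y).
by have [-> ->] := tower_coarsen n _ _ h1 h2.
Qed.

Lemma occurs_bound n (l : 'I_(C n.+1)) (k : 'I_(C n)) i j :
  (j < h n.+1 l)%N -> occurs S n l k j -> (i < h n k)%N -> (j + i < h n.+1 l)%N.
Proof.
move=> hj /andP[/eqP a1 /eqP a2] hi; have [p1 p2] := tower_pos _ _ _ hj.
have [] := tower_belowS n (pos n.+1 l j) i a2; first by rewrite a1.
by move=> _ _ q1 q2; have := ret_lt n.+1 (iter i Ti (pos n.+1 l j)); rewrite q1 q2 p1 p2.
Qed.

Lemma occurs_shift n (l : 'I_(C n.+1)) (k : 'I_(C n)) i j :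
  (j + i < h n.+1 l)%N -> (i < h n k)%N ->
  occurs S n l k j =
  (tower n (pos n.+1 l (j + i)) == k) && (ret n (pos n.+1 l (j + i)) == i).
Proof.
move=> hji hi; have epos : iter i T (pos n.+1 l (j + i)) = pos n.+1 l j.
  by rewrite iter_sTiB ?leq_addl // addnK.
apply/idP/idP => [/andP[/eqP a1 /eqP a2]|/andP[/eqP a1 /eqP a2]].
  have hB : B n k (iter i T (pos n.+1 l (j + i))).
    by rewrite epos -a1; exact: ret0_mem.
  by have [-> ->] := tower_uniq _ _ _ _ hi hB; rewrite !eqxx.
have [q1 q2] : tower n (pos n.+1 l j) = k /\ ret n (pos n.+1 l j) = 0%N.
  rewrite -epos -a1; have [] := ret_iter n (pos n.+1 l (j + i)) i; first by rewrite a2.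
  by rewrite a2 subnn.
by rewrite /occurs q1 q2 !eqxx.
Qed.

(** Each floor of [l] is indexed by the tower [k] of level [n] containing it, its depth [i] there,
    and the depth [j] of the top of that copy. Both the recursion for heights and the one for
    averages come from this. *)
Lemma sum_tower (V : nmodType) n (l : 'I_(C n.+1)) (g : nat -> V) :
  \sum_(0 <= j < h n.+1 l) g j =
  \sum_(k < C n) \sum_(0 <= i < h n k)
    \sum_(0 <= j < h n.+1 l | occurs S n l k j) g (j + i)%N.
Proof.
transitivity (\sum_(k < C n) \sum_(0 <= i < h n k)
    \sum_(0 <= j < h n.+1 l |
      (tower n (pos n.+1 l j) == k) && (ret n (pos n.+1 l j) == i)) g j).
  rewrite (eq_bigr (fun k : 'I_(C n) => \sum_(0 <= j < h n.+1 l)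
     \sum_(0 <= i < h n k | (tower n (pos n.+1 l j) == k) &&
       (ret n (pos n.+1 l j) == i)) g j)); last first.
    by move=> k _; rewrite (exchange_big_dep_nat xpredT).
  rewrite exchange_big /=; apply: eq_bigr => j _.
  rewrite (bigD1 (tower n (pos n.+1 l j))) //= [X in _ + X]big1 ?addr0; last first.
    move=> k /negbTE hk; rewrite big1 // => i; by rewrite eq_sym hk.
  rewrite eqxx /= big_mkord (bigD1 (Ordinal (ret_lt n (pos n.+1 l j)))) //= ?eqxx //.
  rewrite [X in _ + X]big1 ?addr0 // => i /andP[/eqP hi] /eqP hne.
  by case: hne; apply: val_inj.
apply: eq_bigr => k _; rewrite !big_nat; apply: eq_bigr => i /andP[_ hi].
have [hil|hil] := leqP i (h n.+1 l); last first.
  rewrite big_nat_cond [RHS]big_nat_cond !big1 // => j /andP[/andP[_ hj]].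
    by move=> ho; have := occurs_bound _ _ _ i _ hj ho hi; lia.
  case/andP=> _ /eqP hr; have := ret_leS n (pos n.+1 l j).
  by have [_ ->] := tower_pos _ _ _ hj; rewrite hr; lia.
(* Floors of depth below [i] have [ret n < i], and copies whose top is at depth [h n.+1 l - i] or
   more would stick out at the bottom. Both ranges drop out, and the shift by [i] matches the
   rest. *)
rewrite (@big_cat_nat _ _ _ i) //= big_nat_cond big1 ?add0r; last first.
  move=> j /andP[/andP[_ hj] /andP[_ /eqP hr]]; have := ret_leS n (pos n.+1 l j).
  by have [_ ->] := tower_pos _ _ _ (leq_trans hj hil); rewrite hr; lia.
rewrite -{1}(add0n i) big_addn.
rewrite [RHS](@big_cat_nat _ _ _ (h n.+1 l - i)) //= ?leq_subr //.
rewrite [X in _ = _ + X]big_nat_cond [X in _ = _ + X]big1 ?addr0; last first.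
  move=> j /andP[/andP[hj1 hj2] ho]; have := occurs_bound _ _ _ i _ hj2 ho hi; lia.
rewrite big_nat_cond [RHS]big_nat_cond; apply: eq_bigl => j.
by case: ltnP => //= hj; rewrite (occurs_shift n l k i j) //; lia.
Qed.

End TowerTheory.

(** * Incidence matrices and the identity [P(n) H(1) = H(n)] *)

Section Heights.
Context {R : realType} {X : ptopologicalType} (S : kr_system X).
Local Notation T := (sT S).
Local Notation C := (sC S).
Local Notation B := (sB S).
Local Notation h := (sh S).
Local Notation pos := (pos S).
Local Notation first := (first S).

(** An inclusion of atoms is decided by the sample point: one direction is membership of that point,
    the other is (KR2). *)
Lemma MmatE n (l : 'I_(C n.+1)) (k : 'I_(C n)) :
  Mmat X T C B h R n.+1 l k = \sum_(0 <= j < h n.+1 l | occurs S n l k j) 1.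
Proof.
rewrite mxE -sum1_card natr_sum big_mkord; apply: eq_bigl => j.
rewrite unfold_in /in_set; apply/asboolP/idP => [/asboolP hsub|ho].
  have hj := ltn_ord j; have hp : B n.+1 l (iter j T (pos n.+1 l j)).
    by rewrite iter_sTiK; case: cid.
  by have [a1 a2] := mem_tower S n k _ (hsub _ hp); rewrite /occurs a1 a2 !eqxx.
apply/asboolP => x hx; have [x1 x2] := tower_uniq S _ _ _ _ (ltn_ord j) hx.
move: ho; rewrite -{1}x2 occursP // => /andP[/eqP <- /eqP h0]; exact: ret0_mem.
Qed.

Lemma height_rec n (l : 'I_(C n.+1)) : (h n.+1 l)%:R =
  \sum_(k < C n) \sum_(0 <= j < h n.+1 l | occurs S n l k j) (h n k)%:R :> R.
Proof.
have := sum_tower S R n l (fun=> 1); rewrite big_const_nat subn0 iter_addr_0 => ->.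
apply: eq_bigr => k _; rewrite exchange_big /=; apply: eq_bigr => j _.
by rewrite big_const_nat subn0 iter_addr_0.
Qed.

Lemma PmH1 m : Pm X T C B h R m *m H1 C h R = \col_l (h m.+1 l)%:R.
Proof.
elim: m => [|m IH] /=; first by rewrite mul1mx.
rewrite -mulmxA IH; apply/matrixP => l i; rewrite !mxE height_rec.
apply: eq_bigr => k _; rewrite MmatE mxE mulr_suml.
by apply: eq_bigr => j _; rewrite mul1r.
Qed.

End Heights.

(** * Heights modulo one *)

(** This is d(n) of the overview; [dnintv_Pmat] identifies it, for [n > 0], with the norm in the
    series. *)
Definition hdist {R : realType} {X : ptopologicalType} (S : kr_system X) (alpha : R)
  (n : nat) : R := \big[Num.max/0]_(k < sC S n) dnint (alpha * (sh S n k)%:R).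

Section HeightsModuloOne.
Context {R : realType} {X : ptopologicalType} (S : kr_system X) (alpha : R).
Local Notation T := (sT S).
Local Notation Ti := (sTi S).
Local Notation C := (sC S).
Local Notation B := (sB S).
Local Notation h := (sh S).
Local Notation tower := (tower S).
Local Notation ret := (ret S).
Local Notation pos := (pos S).
Local Notation first := (first S).
Local Notation L := (sL S).
Local Notation d := (hdist S alpha).

Lemma dnintv_Pmat n : (0 < n)%N ->
  dnintv (alpha *: (Pmat X T C B h R n *m H1 C h R)) = d n.
Proof.
case: n => // n _; rewrite /dnintv /Pmat /= PmH1.
by apply: eq_bigr => j _; rewrite !mxE.
Qed.

Lemma hdist_ge n (k : 'I_(C n)) : dnint (alpha * (h n k)%:R) <= d n.
Proof. exact: (le_bigmax _ (fun k => dnint (alpha * (h n k)%:R))). Qed.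

Lemma hdist_le n c : 0 <= c -> (forall k : 'I_(C n), dnint (alpha * (h n k)%:R) <= c) ->
  d n <= c.
Proof. by move=> c0 H; apply: bigmax_le => // k _; exact: H. Qed.

Lemma hdist_ge0 n : 0 <= d n.
Proof. by apply: le_trans (hdist_ge n (first n)); exact: dnint_ge0. Qed.

(* Going up tower by tower, [(ret n.+1 w).+1] is a sum of heights of level [n];
   linear recurrence bounds the number of summands. *)
Lemma dnint_cut n w : ret n (Ti w) = 0%N -> exists c : nat,
  (c * h n.+1 (tower n.+1 w) <= L * (ret n.+1 w).+1)%N /\
  dnint (alpha * (ret n.+1 w).+1%:R) <= c%:R * d n.
Proof.
have [q hq] : exists q, q = ret n.+1 w by exists (ret n.+1 w).
move: w hq; elim/ltn_ind: q => q IH w hq h0.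
have := ret_split S n w; set z := iter _ _ _ => -[z1 z2 z3 z4].
(* The point under [w] is in the roof, so [w] is on the lowest floor of its tower of level [n]. *)
have hk : (ret n w).+1 = h n (tower n w).
  have := ret_lt S n w; rewrite leq_eqVlt => /orP[/eqP//|hlt].
  suff [_] : tower n (Ti w) = tower n w /\ ret n (Ti w) = (ret n w).+1 by rewrite h0.
  by apply: tower_uniq => //; rewrite iterSr sTiK; exact: tower_mem.
have hLk := le_sL S n (tower n.+1 w) (tower n w).
have [hz|hz] := posnP (ret n.+1 z).
  exists 1%N; rewrite z2 hz add0n hk !mul1n mul1r; split=> //; exact: hdist_ge.
have [t1 t2] := ret_T S _ _ hz.
have [||c [hc1 hc2]] := IH (ret n.+1 (T z)) _ (T z) erefl.
- rewrite hq t2 z2; lia.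
- by rewrite sTK z4.
rewrite t1 t2 prednK // z1 in hc1 hc2.
exists c.+1; rewrite z2 -addnS hk; split; first by rewrite mulSn mulnDr addnC leq_add.
rewrite natrD mulrDr -natr1 mulrDl mul1r; apply: le_trans (dnintD _ _) _.
by apply: lerD => //; exact: hdist_ge.
Qed.

(** Apply [dnint_cut] on the lowest floor of [l]: there [(ret n.+1 w).+1] is the whole height, so
    there are at most [L] summands. *)
Lemma dnint_height_le n (l : 'I_(C n.+1)) :
  dnint (alpha * (h n.+1 l)%:R) <= L%:R * d n.
Proof.
have hl := h_gt0 S n.+1 l.
have hlt : ((h n.+1 l).-1 < h n.+1 l)%N by rewrite prednK.
have := tower_pos S _ _ _ hlt; set w := pos _ _ _ => -[p1 p2].
have hw : ret n (Ti w) = 0%N.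
  apply: (ret_first S _ _ _).2; apply/eqP; rewrite -leqn0 leqNgt; apply/negP => hpos.
  have [] := ret_T S _ _ hpos; rewrite sTiK p1 p2 => e1 e2.
  by have := ret_lt S n.+1 (Ti w); rewrite -e1; lia.
have [c] := dnint_cut n w hw; rewrite p1 p2 prednK // leq_pmul2r // => -[c1 c2].
by apply: le_trans c2 _; rewrite ler_wpM2r ?hdist_ge0 // ler_nat.
Qed.

Lemma hdistS_le n : d n.+1 <= L%:R * d n.
Proof.
apply: hdist_le => [|l]; first by rewrite mulr_ge0 ?hdist_ge0.
exact: dnint_height_le.
Qed.

(** Unless [y] is on top, [T y] is at the bottom of a copy and [(ret n.+1 (T y)).+1 = ret n.+1 y] is
    less than the height of the tower, so [dnint_cut] again yields at most [L] summands. *)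
Lemma dnint_visit_le n y : ret n y = 0%N -> dnint (alpha * (ret n.+1 y)%:R) <= L%:R * d n.
Proof.
move=> h0; have [hy|hy] := posnP (ret n.+1 y).
  by rewrite hy mulr0 dnint0 mulr_ge0 ?hdist_ge0.
have [t1 t2] := ret_T S _ _ hy.
have [|c] := dnint_cut n (T y); first by rewrite sTK.
rewrite t1 t2 prednK // => -[c1 c2].
apply: le_trans c2 _; rewrite ler_wpM2r ?hdist_ge0 // ler_nat.
rewrite -(leq_pmul2r (h_gt0 S n.+1 (tower n.+1 y))); apply: leq_trans c1 _.
by rewrite leq_mul2l ltnW ?orbT // ret_lt.
Qed.

Lemma dnint_step_le n x : dnint (alpha * (ret n.+1 x - ret n x)%:R) <= L%:R * d n.
Proof.
have [_ z2 _ z4] := ret_split S n x; rewrite z2 addnK; exact: dnint_visit_le.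
Qed.

(* If the last floor of tower [first n.+1] belongs to tower [k], then [h n k]
   is the difference of [h n.+1 (first n.+1)] and a visit time, and the former
   is itself a visit time one level up as [1 < C n.+1]. *)
Lemma hdist_le_visits n e0 e1 : (1 < C n.+1)%N -> 0 <= e0 -> 0 <= e1 ->
  (forall y, tower n.+1 y = first n.+1 -> ret n y = 0%N ->
     dnint (alpha * (ret n.+1 y)%:R) <= e0) ->
  (forall y, tower n.+2 y = first n.+2 -> ret n.+1 y = 0%N ->
     dnint (alpha * (ret n.+2 y)%:R) <= e1) ->
  d n <= 2 * e0 + e1.
Proof.
move=> hC e00 e10 H0 H1; apply: hdist_le => [|k]; first by lra.
have [y [y1 y2 y3]] := visit_ex S n (first n.+1) k.
have hy := H0 y y1 y3.
have key z : dnint (alpha * (ret n.+1 y + h n k)%:R) <= z -> dnint (alpha * (h n k)%:R) <= z + e0.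
  move=> hz; have -> : alpha * (h n k)%:R =
      alpha * (ret n.+1 y + h n k)%:R - alpha * (ret n.+1 y)%:R.
    by rewrite natrD; ring.
  by apply: le_trans (dnintB _ _) _; exact: lerD.
have := next_visit S n y y3; rewrite y2 => -[hlast|[y' [y'1 y'2 y'3]]]; last first.
  have := key e0; rewrite -y'2 => /(_ (H0 y' _ y'3)); rewrite y'1 y1 => /(_ erefl); lra.
suff : dnint (alpha * (ret n.+1 y + h n k)%:R) <= e1 by move/key; lra.
rewrite hlast y1.
(* Counted from the top of [first n.+2], the second visit to the roof of level [n.+1] is at depth
   [h n.+1 (first n.+1)]; it exists because the two heights differ. *)
have h00 : (0 < h n.+2 (first n.+2))%N by exact: h_gt0.
have := tower_pos S _ _ _ h00; set w := pos _ _ _ => -[p1 p2].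
have [q1 q2] := ret_first S _ _ p2.
have [hl|[w' [w'1 w'2 w'3]]] := next_visit S n.+1 w q2.
  by move: (roof_first_ne S n hC); rewrite -p1 -hl p2 q1 add0n eqxx.
by have := H1 w' _ w'3; rewrite w'1 w'2 p1 p2 q1 add0n; apply.
Qed.

End HeightsModuloOne.

(** * The cocycle of signed residues *)

Section Cocycle.
Context {R : realType} {X : ptopologicalType} (S : kr_system X) (alpha : R).
Local Notation T := (sT S).
Local Notation tower := (tower S).
Local Notation ret := (ret S).
Local Notation first := (first S).
Local Notation L := (sL S).
Local Notation d := (hdist S alpha).

Definition rstep n (x : X) : R := sres (alpha * (ret n.+1 x - ret n x)%:R).

(** A real lift of [alpha * (ret n x - ret m x)] modulo 1 built from small increments, so that it
    has a chance to converge. *)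
Definition rho m n (x : X) : R := \sum_(m <= i < n) rstep i x.

Lemma norm_rstep n x : `|rstep n x| <= L%:R * d n.
Proof. by rewrite norm_sres dnint_step_le. Qed.

Lemma rho_mod1 m n x : (m <= n)%N ->
  exists z : int, rho m n x = alpha * (ret n x)%:R - alpha * (ret m x)%:R + z%:~R.
Proof.
move=> /subnKC <-; elim: (n - m)%N => [|i [z IH]].
  by exists 0; rewrite addn0 subrr addr0 /rho big_geq.
exists (z - nearint (alpha * (ret (m + i).+1 x - ret (m + i) x)%:R)).
rewrite /rho addnS big_nat_recr ?leq_addr //= -/(rho m (m + i) x) IH /rstep /sres.
by rewrite natrB ?ret_leS // intrB; ring.
Qed.

Lemma ret0 x : ret 0 x = 0%N.
Proof.
have [_ [_ H] _ _ _] := sys_KR _ S.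
by have := ret_lt S 0 x; have [_ ->] := H (tower 0 x); case: (ret 0 x).
Qed.

Lemma rho_const m n x y : tower n x = tower n y -> ret n x = ret n y ->
  rho m n x = rho m n y.
Proof.
elim: n => [|n IH] ht hr; first by rewrite /rho !big_geq.
have [ht' hr'] := tower_coarsen S n _ _ ht hr.
have [hmn|hmn] := leqP m n; last by rewrite /rho !big_geq.
by rewrite /rho !big_nat_recr //= -!/(rho _ _ _) IH // /rstep hr hr'.
Qed.

Lemma rho_T n x : ret n x <> 0%N ->
  exists z : int, rho 0 n (T x) = rho 0 n x - alpha + z%:~R.
Proof.
move=> /eqP; rewrite -lt0n => h0; have [_ hr] := ret_T S n x h0.
have [z1 ->] := rho_mod1 0 n (T x) isT; have [z2 ->] := rho_mod1 0 n x isT.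
exists (z1 - z2); rewrite hr !ret0 intrB.
have -> : (ret n x)%:R = (ret n x).-1%:R + 1 :> R by rewrite natr1 prednK.
ring.
Qed.

(** [T] lowers [rho] by [alpha] modulo 1 once [x] is outside the roof, and then at all finer levels
    too. The subsequence [N] and the constants [c] serve the measurable case. *)
Lemma rho_T_cvg (N : nat -> nat) (c : nat -> R) x (l : R) : (forall i, (i <= N i)%N) ->
  (exists n, ret n x <> 0%N) -> (fun i => rho 0 (N i) x - c i) @ \oo --> l ->
  (fun i => cos (2 * pi * (rho 0 (N i) (T x) - c i))) @ \oo --> cos (2 * pi * (l - alpha)) /\
  (fun i => sin (2 * pi * (rho 0 (N i) (T x) - c i))) @ \oo --> sin (2 * pi * (l - alpha)).
Proof.
move=> hN [n0 hn0] hl.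
have hz i : (n0 <= i)%N -> exists z : int, rho 0 (N i) (T x) - c i =
    rho 0 (N i) x - c i - alpha + z%:~R.
  move=> hi; have [|z ->] := rho_T (N i) x.
    by have := ret_le S n0 (N i) x (leq_trans hi (hN i)); lia.
  by exists z; ring.
have hl' : (fun i => 2 * pi * (rho 0 (N i) x - c i - alpha)) @ \oo --> 2 * pi * (l - alpha).
  apply: cvgMr; apply: cvgB => //; exact: cvg_cst.
split.
  have := cvg_comp _ _ hl' (@continuous_cos R _).
  apply: cvg_trans; apply: near_eq_cvg; near=> i.
  have [|z ->] := hz i; first by near: i; exact: nbhs_infty_ge.
  by rewrite cos2piDint.
have := cvg_comp _ _ hl' (@continuous_sin R _).
apply: cvg_trans; apply: near_eq_cvg; near=> i.
have [|z ->] := hz i; first by near: i; exact: nbhs_infty_ge.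
by rewrite sin2piDint.
Unshelve. all: by end_near. Qed.

Lemma ret_ne0_ex : exists u : X, (forall n, ret n u = 0%N) /\
  forall x, x != u -> exists n, ret n x <> 0%N.
Proof.
have [_ _ _ _ [[u hu] _ _ _ _]] := sys_KR _ S.
exists u; split => [n|x /eqP hx].
  by apply/roofP; have : [set u] u by []; rewrite -hu; apply.
apply: contrapT => /forallNP hn; apply: hx.
have : [set u] x; last by [].
by rewrite -hu => n _; apply/roofP; apply: contrapT; exact: hn.
Qed.

End Cocycle.

(** * Openness of atoms and local constancy of tower coordinates *)

Section LocalConstancy.
Context {X : ptopologicalType} (S : kr_system X).
Local Notation T := (sT S).
Local Notation C := (sC S).
Local Notation B := (sB S).
Local Notation tower := (tower S).
Local Notation ret := (ret S).
Local Notation first := (first S).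

Lemma continuous_iterT j : continuous (iter j T).
Proof.
have [_ [cT _ _ _] _] := sys_minimal _ S.
elim: j => [|j IH] x /=; first exact: cvg_id.
by apply: continuous_comp; [exact: IH|exact: cT].
Qed.

Lemma clopen_sB n (k : 'I_(C n)) : clopen (B n k).
Proof. by have [H _ _ _] := sys_partition S n; have [] := H k. Qed.

Lemma open_atom n (k : 'I_(C n)) j : open (Tinvj X T j (B n k)).
Proof.
apply: open_comp; first by move=> x _; exact: continuous_iterT.
by have [] := clopen_sB n k.
Qed.

Lemma near_tower n x : \forall y \near x, tower n y = tower n x /\ ret n y = ret n x.
Proof.
have : nbhs x (Tinvj X T (ret n x) (B n (tower n x))).
  by apply: open_nbhs_nbhs; split; [exact: open_atom|exact: tower_mem].
by apply: filterS => y; apply: tower_uniq; exact: ret_lt.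
Qed.

End LocalConstancy.

(** * Uniform convergence of series of functions *)

Section UniformSeries.
Context {R : realType} {X : Type}.

(** The Weierstrass test over a bare type: with [X = unit] it also handles numerical series. *)
Lemma uniform_series (u : nat -> X -> R) (b : nat -> R) (K : R) :
  (forall m x, `|u m x| <= b m) -> (forall n, \sum_(0 <= m < n) b m <= K) ->
  exists f : X -> R, forall e : R, 0 < e -> exists N, forall n x, (N <= n)%N ->
    `|f x - \sum_(0 <= m < n) u m x| <= e.
Proof.
move=> hub hK.
have b0 m : forall x : X, 0 <= b m by move=> x; apply: le_trans (hub m x).
(* Nonnegativity of [b] is read off at a point, so an empty [X] is set apart. *)
have [x0|noX] := pselect (inhabited X); last first.
  by exists (fun=> 0) => e e0; exists 0%N => n x; case: (noX (inhabits x)).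
have {}b0 m : 0 <= b m by case: x0 => x; exact: b0 x.
have cb : cvgn (series b).
  apply: nondecreasing_is_cvgn.
    apply/nondecreasing_seqP => n; by rewrite !seriesEnat /= big_nat_recr //= lerDl.
  exists K; apply/ubP => _ [n _ <-]; rewrite seriesEnat; exact: hK.
have tail n m : (n <= m)%N -> series b m - series b n = \sum_(n <= i < m) b i.
  move=> hnm; rewrite !seriesEnat /= (@big_cat_nat _ _ _ n 0 m) //=; ring.
have cu x : cvgn (series (fun m => u m x)).
  apply: normed_cvg; apply: (series_le_cvg _ _ _ cb) => n //=.
exists (fun x => limn (series (fun m => u m x))) => e e0.
have /cvgrPdist_le /(_ e e0) [N _ HN] := cb.
exists N => n x hn.
have hlim : (fun m => `|series (fun m => u m x) m - series (fun m => u m x) n|) @ \oo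
    --> `|limn (series (fun m => u m x)) - series (fun m => u m x) n|.
  by apply: cvg_norm; apply: cvgB; [exact: cu|exact: cvg_cst].
have -> : \sum_(0 <= m < n) u m x = series (fun m => u m x) n by rewrite seriesEnat.
rewrite -(cvg_lim _ hlim) //; apply: limr_le; first by apply/cvg_ex; eexists; exact: hlim.
near=> m.
have hnm : (n <= m)%N by near: m; exact: nbhs_infty_ge.
rewrite !seriesEnat /= (@big_cat_nat _ _ _ n 0 m) //= addrAC subrr add0r.
apply: le_trans (ler_norm_sum _ _ _) _; apply: (@le_trans _ _ (\sum_(n <= i < m) b i)).
  by apply: ler_sum => i _; exact: hub.
apply: le_trans (HN n hn); rewrite -tail //; apply: le_trans (ler_norm _).
rewrite lerD2r; apply: nondecreasing_cvgn_le => //.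
by apply/nondecreasing_seqP => i; rewrite !seriesEnat /= big_nat_recr //= lerDl.
Unshelve. all: by end_near. Qed.

End UniformSeries.

(** * Summability gives a continuous eigenvalue *)

Section ContinuousSufficiency.
Context {R : realType} {X : ptopologicalType} (S : kr_system X) (alpha : R).
Local Notation T := (sT S).
Local Notation first := (first S).
Local Notation L := (sL S).
Local Notation d := (hdist S alpha).
Local Notation rho := (rho S alpha).

Lemma continuous_eigenvalue_of_summable (K : R) : (forall N, \sum_(0 <= n < N) d n <= K) ->
  continuous_eigenvalue R X T alpha.
Proof.
move=> hK.
have [|r hr] := @uniform_series R X (rstep S alpha) (fun n => L%:R * d n) (L%:R * K)
  (norm_rstep S alpha).
  by move=> n; rewrite -mulr_sumr ler_wpM2l.
(* The partial sums are constant on atoms, which are open, and they converge uniformly. *)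
have cr : continuous r.
  move=> x; apply/cvgrPdist_le => e e0.
  have e20 : 0 < e / 2 by rewrite divr_gt0.
  have [N HN] := hr (e / 2) e20.
  have := near_tower S N x; apply: filterS => y [ht hret].
  have h1 := HN N x (leqnn _); have h2 := HN N y (leqnn _).
  have hc : \sum_(0 <= m < N) rstep S alpha m y = \sum_(0 <= m < N) rstep S alpha m x :=
    rho_const S alpha 0 N y x ht hret.
  rewrite hc in h2.
  move: h1 h2; rewrite !ler_norml; lra.
have cvr x : (fun i => rho 0 i x - 0) @ \oo --> r x.
  apply/cvgrPdist_le => e e0; have [N HN] := hr e e0.
  by exists N => // n /= hn; rewrite subr0; exact: HN.
have [cantorX [cT _ _ _] _] := sys_minimal _ S.
have [u [_ hu]] := ret_ne0_ex S.
have heq x : x != u ->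
    cos (2 * pi * r (T x)) = cos (2 * pi * (r x - alpha)) /\
    sin (2 * pi * r (T x)) = sin (2 * pi * (r x - alpha)).
  move=> hx; have [c1 c2] := rho_T_cvg S alpha id (fun=> 0) x (r x) (fun i => leqnn i) (hu x hx) (cvr x).
  have hT : (fun i => 2 * pi * (rho 0 i (T x) - 0)) @ \oo --> 2 * pi * r (T x).
    by apply: cvgMr; exact: cvr.
  have t1 := cvg_comp _ _ hT (@continuous_cos R _).
  have t2 := cvg_comp _ _ hT (@continuous_sin R _).
  split; [apply: (cvg_unique _ t1 c1)|apply: (cvg_unique _ t2 c2)]; exact: norm_hausdorff.
have cf1 : continuous (fun x => cos (2 * pi * r x)).
  move=> x; apply: (@cvg_comp _ _ _ _ cos _ _ _ _ (@continuous_cos R _)).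
  by apply: cvgMr; exact: cr.
have cf2 : continuous (fun x => sin (2 * pi * r x)).
  move=> x; apply: (@cvg_comp _ _ _ _ sin _ _ _ _ (@continuous_sin R _)).
  by apply: cvgMr; exact: cr.
(* the point [u] of the intersection of the roofs is not isolated *)
have ext (g : X -> R) : continuous g -> (forall x, x != u -> g x = 0) -> forall x, g x = 0.
  move=> cg g0 x; have [->|] := eqVneq x u; last exact: g0.
  apply: contrapT => /eqP gu; have [[_ hp] _ _ _] := cantorX.
  have : limit_point [set: X] u by rewrite hp.
  have hnb : nbhs u [set y | g y != 0].
    have := cg u; move/cvgrPdist_lt => /(_ `|g u|); rewrite normr_gt0 => /(_ gu).
    apply: filterS => y /=; apply: contraTN => /eqP ->; by rewrite subr0 ltxx.
  by move=> /(_ _ hnb) [y [/g0 y1 _ /=]]; rewrite y1 eqxx.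
have cfT (g : X -> R) : continuous g -> continuous (g \o T).
  by move=> cg x; apply: continuous_comp; [exact: cT|exact: cg].
(* The minus sign comes from [r (T x) = r x - alpha] modulo 1 for [x != u]: the eigenfunction is
   [exp (-2 i pi r)]. *)
exists (fun x => cos (2 * pi * r x)), (fun x => - sin (2 * pi * r x)); split => //.
- by move=> x; apply: cvgN; exact: cf2.
- exists point; have := cos2Dsin2 (2 * pi * r point).
  have [->|h1] := eqVneq (cos (2 * pi * r point)) 0; last by move=> _; left.
  have [->|h2] := eqVneq (sin (2 * pi * r point)) 0; last by move=> _; right; rewrite oppr_eq0.
  by rewrite expr0n addr0 => /eqP; rewrite eq_sym oner_eq0.
move=> x; split; apply/eqP; rewrite -subr_eq0; apply/eqP; move: x; apply: ext.
- move=> x; apply: cvgB; first exact: (cfT _ cf1).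
  by apply: cvgB; [apply: cvgMr; exact: cf1|apply: cvgMr; apply: cvgN; exact: cf2].
- move=> x /heq [-> _]; rewrite mulrBr cosB; ring.
- move=> x; apply: cvgB; first by apply: cvgN; exact: (cfT _ cf2).
  by apply: cvgD; [apply: cvgMr; exact: cf1|apply: cvgMr; apply: cvgN; exact: cf2].
- move=> x /heq [_ ->]; rewrite mulrBr sinB; ring.
Qed.

End ContinuousSufficiency.

(** * Invariant measure of the towers *)

Section Measure.
Context {R : realType} {X : ptopologicalType} (S : kr_system X).
Variables (mu : probability (borelX X) R).
Hypothesis inv : T_invariant R X (sT S) mu.
Local Notation T := (sT S).
Local Notation C := (sC S).
Local Notation B := (sB S).
Local Notation h := (sh S).
Local Notation tower := (tower S).
Local Notation ret := (ret S).
Local Notation first := (first S).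
Local Notation L := (sL S).

Definition bmeasurable (A : set X) : Prop := measurable (A : set (borelX X)).

(** A common frame for [mu] and for integrals over sets, so that cutting along atoms is done only
    once. *)
Definition fadditive (F : set X -> R) : Prop := forall A D : set X,
  bmeasurable A -> bmeasurable D -> A `&` D = set0 -> F (A `|` D) = F A + F D.

Lemma open_bmeasurable (A : set X) : open A -> bmeasurable A.
Proof. by move=> oA; apply: sub_sigma_algebra. Qed.

Lemma bmeasurable_T (A : set X) : bmeasurable A -> bmeasurable (T @^-1` A).
Proof.
have [_ [cT _ _ _] _] := sys_minimal _ S.
have mT : measurable_fun setT (T : borelX X -> borelX X).
  apply: (@measurability _ _ (borelX X) (borelX X) _ _ (@open X)) => // _ [U oU <-].
  by rewrite setTI; apply: open_bmeasurable; apply: open_comp => // x _; exact: cT.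
by move=> mA; have := mT measurableT _ mA; rewrite setTI.
Qed.

Lemma TinvjS j (A : set X) : Tinvj X T j.+1 A = T @^-1` (Tinvj X T j A).
Proof. by apply/seteqP; split => x; rewrite /Tinvj /preimage /mkset iterSr. Qed.

Lemma bmeasurable_Tinvj j (A : set X) : bmeasurable A -> bmeasurable (Tinvj X T j A).
Proof. by move=> mA; elim: j => [//|j IH]; rewrite TinvjS; exact: bmeasurable_T. Qed.

Lemma mu_Tinvj j (A : set X) : bmeasurable A -> mu (Tinvj X T j A) = mu A.
Proof.
move=> mA; elim: j => [//|j IH]; rewrite TinvjS inv //; exact: bmeasurable_Tinvj.
Qed.

Lemma bmeasurable_sB n (k : 'I_(C n)) : bmeasurable (B n k).
Proof. by apply: open_bmeasurable; have [] := clopen_sB S n k. Qed.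

Lemma open_tower n (k : 'I_(C n)) : open [set x | tower n x = k].
Proof.
rewrite openE => x /= <-; have := near_tower S n x.
by apply: filterS => y [].
Qed.

Lemma open_ret n j : open [set x | ret n x = j].
Proof.
rewrite openE => x /= <-; have := near_tower S n x.
by apply: filterS => y [].
Qed.

Lemma fadditive_set0 F : fadditive F -> F set0 = 0.
Proof.
move=> hF; have := hF set0 set0; rewrite setU0 setI0.
have m0 : bmeasurable set0 by exact: measurable0.
move=> /(_ m0 m0 erefl) h0; apply: (@addrI _ (F set0)); by rewrite -h0 addr0.
Qed.

Lemma fadditive_nat F (A : set X) (c : X -> nat) N : fadditive F -> bmeasurable A ->
  (forall i, bmeasurable [set x | c x = i]) -> (forall x, A x -> (c x < N)%N) ->
  F A = \sum_(0 <= i < N) F (A `&` [set x | c x = i]).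
Proof.
move=> hF mA mc; have F0 := fadditive_set0 F hF.
have mlt n : bmeasurable [set x | (c x < n)%N].
  elim: n => [|n IH].
    have -> : [set x | (c x < 0)%N] = set0 by apply/seteqP; split.
    exact: measurable0.
  have -> : [set x | (c x < n.+1)%N] = [set x | (c x < n)%N] `|` [set x | c x = n].
    apply/seteqP; split => x /=; first by rewrite ltnS leq_eqVlt => /orP[/eqP|]; [right|left].
    by case=> [|->]; [exact: ltnW|].
  exact: measurableU _ _ IH (mc n).
have key n : F (A `&` [set x | (c x < n)%N]) = \sum_(0 <= i < n) F (A `&` [set x | c x = i]).
  elim: n => [|n IH].
    by rewrite big_geq // -F0; congr F; apply/seteqP; split => x //= -[].
  rewrite big_nat_recr //= -IH -hF; [congr F|exact: measurableI _ _ mA (mlt n)|exact: measurableI _ _ mA (mc n)|].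
    rewrite -setIUr; congr (_ `&` _); apply/seteqP; split => x /=.
      by rewrite ltnS leq_eqVlt => /orP[/eqP|]; [right|left].
    by case=> [|->]; [exact: ltnW|].
  apply/seteqP; split => // x /= [[_ h1] [_ h2]]; by move: h1; rewrite h2 ltnn.
move=> hN; rewrite -key; congr F; apply/seteqP; split => x /=; last by case.
by move=> Ax; split => //; exact: hN.
Qed.

Lemma fadditive_atoms F (A : set X) n : fadditive F -> bmeasurable A ->
  F A = \sum_(k < C n) \sum_(0 <= j < h n k) F (A `&` Tinvj X T j (B n k)).
Proof.
move=> hF mA.
have mt i : bmeasurable [set x | tower n x = i :> nat].
  case: (ltnP i (C n)) => hi.
    have -> : [set x | tower n x = i :> nat] = [set x | tower n x = Ordinal hi].
      by apply/seteqP; split => x /=; [move=> hx; apply: val_inj|move=> ->].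
    by apply: open_bmeasurable; exact: open_tower.
  have -> : [set x | tower n x = i :> nat] = set0.
    apply/seteqP; split => x //= hx; by have := ltn_ord (tower n x); rewrite hx; lia.
  exact: measurable0.
rewrite (fadditive_nat F A (fun x => tower n x) (C n) hF mA mt); last by move=> x _.
rewrite big_mkord; apply: eq_bigr => k _.
have mr i : bmeasurable [set x | ret n x = i] by apply: open_bmeasurable; exact: open_ret.
rewrite (fadditive_nat F _ (ret n) (h n k) hF (measurableI _ _ mA (mt k)) mr); last first.
  by move=> x /= [_ /val_inj <-]; exact: ret_lt.
rewrite !big_nat; apply: eq_bigr => j /andP[_ hj].
rewrite -setIA; congr (F (_ `&` _)); apply/seteqP; split => x /=.
  by move=> [/val_inj <- <-]; exact: tower_mem.
by move=> hx; have [-> ->] := tower_uniq S n k j x hj hx.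
Qed.

(** Each atom of level [n.+1] is either contained in [B n k] or disjoint from it. *)
Lemma fadditive_sB F n (k : 'I_(C n)) : fadditive F -> F (B n k) =
  \sum_(l < C n.+1) \sum_(0 <= j < h n.+1 l | occurs S n l k j) F (Tinvj X T j (B n.+1 l)).
Proof.
move=> hF; rewrite (fadditive_atoms F (B n k) n.+1 hF (bmeasurable_sB n k)).
apply: eq_bigr => l _; rewrite [RHS]big_mkcond !big_nat; apply: eq_bigr => j /andP[_ hj].
case: ifPn => hocc.
  congr F; apply/seteqP; split => x /=; first by case.
  move=> hx; split => //.
  have [x1 x2] := tower_uniq S n.+1 l j x hj hx.
  by move: hocc; rewrite -{1}x2 occursP // => /andP[/eqP <- /eqP ?]; exact: ret0_mem.
rewrite (_ : _ `&` _ = set0) ?fadditive_set0 //; apply/seteqP; split => // x /= [hk hx].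
have [x1 x2] := tower_uniq S n.+1 l j x hj hx; have [y1 y2] := mem_tower S n k x hk.
by move: hocc; rewrite -{1}x2 occursP // y1 y2 !eqxx.
Qed.

Lemma fadditive_mu : fadditive (fun A => fine (mu (A : set (borelX X)))).
Proof.
move=> A D mA mD AD; rewrite measureU // fineD //; exact: fin_num_measure.
Qed.

Definition mass n (k : 'I_(C n)) : R := fine (mu (B n k : set (borelX X))).

Lemma mass_ge0 n k : 0 <= mass n k.
Proof. by rewrite fine_ge0. Qed.

Lemma mass_atom n k j : fine (mu (Tinvj X T j (B n k) : set (borelX X))) = mass n k.
Proof. by rewrite mu_Tinvj //; exact: bmeasurable_sB. Qed.

Lemma sum_height_mass n : \sum_(k < C n) (h n k)%:R * mass n k = 1.
Proof.
have h1 : fine (mu ([set: X] : set (borelX X))) = 1 by rewrite probability_setT.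
rewrite -[RHS]h1 (fadditive_atoms _ [set: X] n fadditive_mu measurableT); apply: eq_bigr => k _.
rewrite (eq_bigr (fun=> mass n k)); last by move=> j _; rewrite setTI mass_atom.
by rewrite big_const_nat subn0 iter_addr_0 mulr_natl.
Qed.

Lemma mass_rec n (k : 'I_(C n)) : mass n k =
  \sum_(l < C n.+1) \sum_(0 <= j < h n.+1 l | occurs S n l k j) mass n.+1 l.
Proof.
rewrite /mass (fadditive_sB _ n k fadditive_mu); apply: eq_bigr => l _.
by apply: eq_bigr => j _; rewrite mass_atom.
Qed.

Lemma occurs_ex n (l : 'I_(C n.+1)) (k : 'I_(C n)) :
  exists j : 'I_(h n.+1 l), occurs S n l k j.
Proof.
have [y [y1 y2 y3]] := visit_ex S n l k.
have hy := ret_lt S n.+1 y; rewrite y1 in hy.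
by exists (Ordinal hy); rewrite /= occursP // y2 y3 !eqxx.
Qed.

(** In the identity [sum_height_mass] at level [n.+1], (LR) replaces each height by [L * h n k], and
    (KR5) provides at least one copy of [k] in every [l]. *)
Lemma height_mass_ge n (k : 'I_(C n)) : 1 <= L%:R * ((h n k)%:R * mass n k).
Proof.
rewrite -[X in X <= _](sum_height_mass n.+1) (mass_rec n k) !mulr_sumr; apply: ler_sum => l _.
have [j hj] := occurs_ex n l k; rewrite big_mkord (bigD1 j) //= mulrDr mulrDr.
rewrite -[X in X <= _]addr0; apply: lerD.
  by rewrite mulrA -natrM ler_wpM2r ?mass_ge0 // ler_nat le_sL.
by rewrite !mulr_ge0 // sumr_ge0 // => i _; exact: mass_ge0.
Qed.

Lemma mass_gt0 n (k : 'I_(C n)) : 0 < mass n k.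
Proof.
rewrite lt_neqAle mass_ge0 andbT eq_sym; apply/eqP => h0.
by have := height_mass_ge n k; rewrite h0 !mulr0 ler10.
Qed.

Lemma height_mass_le1 n (k : 'I_(C n)) : (h n k)%:R * mass n k <= 1.
Proof.
rewrite -[X in _ <= X](sum_height_mass n) (bigD1 k) //= lerDl sumr_ge0 // => i _.
by rewrite mulr_ge0 ?mass_ge0.
Qed.

Lemma height_massS_ge n (k : 'I_(C n)) (l : 'I_(C n.+1)) :
  1 <= L%:R ^+ 2 * ((h n k)%:R * mass n.+1 l).
Proof.
apply: le_trans (height_mass_ge n.+1 l) _.
rewrite expr2 -mulrA ler_wpM2l // mulrA ler_wpM2r ?mass_ge0 //.
by rewrite -natrM ler_nat le_sL.
Qed.

(** After multiplication by [h n k] both sides compare with 1. This is the source of the Doeblin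
    constant [L^-2]. *)
Lemma mass_le_massS n (k : 'I_(C n)) (l : 'I_(C n.+1)) :
  mass n k <= L%:R ^+ 2 * mass n.+1 l.
Proof.
rewrite -(@ler_pM2l _ (h n k)%:R) ?ltr0n ?h_gt0 //.
apply: le_trans (height_mass_le1 n k) _.
by rewrite mulrCA; exact: height_massS_ge.
Qed.

End Measure.

(** * Second moments of the cocycle *)

Section Moments.
Context {R : realType} {X : ptopologicalType} (S : kr_system X).
Variables (mu : probability (borelX X) R) (alpha : R).
Hypothesis inv : T_invariant R X (sT S) mu.
Local Notation C := (sC S).
Local Notation h := (sh S).
Local Notation tower := (tower S).
Local Notation pos := (pos S).
Local Notation first := (first S).
Local Notation L := (sL S).
Local Notation d := (hdist S alpha).
Local Notation rho := (rho S alpha).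
Local Notation mass := (mass S mu).

(** Conditional expectation given [B n k] of a function of the atom [T^-j B_l(n+1)] inside it. *)
Definition avg n (k : 'I_(C n)) (F : 'I_(C n.+1) -> nat -> R) : R :=
  (\sum_(l < C n.+1) \sum_(0 <= j < h n.+1 l | occurs S n l k j) mass n.+1 l * F l j)
  / mass n k.

(** The integral of a function constant on the atoms of level [n], as a finite sum; see
    [integral_level]. *)
Definition ave n (F : X -> R) : R :=
  \sum_(k < C n) \sum_(0 <= i < h n k) mass n k * F (pos n k i).

Lemma avg_le n (k : 'I_(C n)) F G :
  (forall l j, (j < h n.+1 l)%N -> occurs S n l k j -> F l j <= G l j) ->
  avg n k F <= avg n k G.
Proof.
move=> FG; rewrite ler_wpM2r ?invr_ge0 ?mass_ge0 //; apply: ler_sum => l _.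
rewrite big_nat_cond [X in _ <= X]big_nat_cond; apply: ler_sum => j /andP[/andP[_ hj] ho].
by rewrite ler_wpM2l ?mass_ge0 // FG.
Qed.

Lemma avg_cst n (k : 'I_(C n)) c : avg n k (fun _ _ => c) = c.
Proof.
rewrite /avg; under eq_bigr do rewrite -mulr_suml.
rewrite -mulr_suml -(mass_rec S mu inv) mulrAC mulfV ?mul1r //.
by rewrite gt_eqF // (mass_gt0 S mu inv).
Qed.

Lemma avgD n (k : 'I_(C n)) F G :
  avg n k (fun l j => F l j + G l j) = avg n k F + avg n k G.
Proof.
rewrite /avg -mulrDl -big_split /=; congr (_ / _); apply: eq_bigr => l _.
by rewrite -big_split /=; apply: eq_bigr => j _; rewrite mulrDr.
Qed.

Lemma avgZ n (k : 'I_(C n)) c F : avg n k (fun l j => c * F l j) = c * avg n k F.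
Proof.
rewrite /avg mulrA mulr_sumr; congr (_ / _); apply: eq_bigr => l _.
by rewrite mulr_sumr; apply: eq_bigr => j _; rewrite mulrCA.
Qed.

(* Doeblin's condition: a visit of a given tower has conditional probability at
   least [L^-2]. *)
Lemma avg_ge_visit n (k : 'I_(C n)) F l0 j0 : (j0 < h n.+1 l0)%N -> occurs S n l0 k j0 ->
  (forall l j, (j < h n.+1 l)%N -> occurs S n l k j -> 0 <= F l j) ->
  L%:R ^- 2 * F l0 j0 <= avg n k F.
Proof.
move=> hj0 ho0 F0; rewrite /avg ler_pdivlMr ?(mass_gt0 S mu inv) //.
have sum0 l : 0 <= \sum_(0 <= j < h n.+1 l | occurs S n l k j) mass n.+1 l * F l j.
  rewrite big_nat_cond; apply: sumr_ge0 => j /andP[/andP[_ hj] ho].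
  by rewrite mulr_ge0 ?mass_ge0 // F0.
rewrite (bigD1 l0) //= -[X in X <= _]addr0; apply: lerD; last by apply: sumr_ge0.
rewrite big_mkord (bigD1 (Ordinal hj0)) //= -[X in X <= _]addr0; apply: lerD; last first.
  by apply: sumr_ge0 => j /andP[ho _]; rewrite mulr_ge0 ?mass_ge0 // F0.
rewrite mulrAC [X in X <= _]mulrC [X in _ <= X]mulrC ler_wpM2l ?F0 //.
rewrite ler_pdivrMl ?exprn_gt0 ?ltr0n ?sL_gt0 //; exact: (mass_le_massS S mu inv).
Qed.

(** The tower property of conditional expectation: [sum_tower] groups the floors of level [n.+1] by
    the atom of level [n] containing them. *)
Lemma ave_step n (F : X -> R) : ave n.+1 F =
  \sum_(k < C n) \sum_(0 <= i < h n k)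
    mass n k * avg n k (fun l j => F (pos n.+1 l (j + i))).
Proof.
rewrite /ave; under eq_bigr do rewrite -mulr_sumr sum_tower mulr_sumr.
rewrite exchange_big /=; apply: eq_bigr => k _.
under eq_bigr do rewrite mulr_sumr.
rewrite exchange_big /=; apply: eq_bigr => i _.
rewrite /avg mulrCA mulfV ?mulr1 ?gt_eqF ?(mass_gt0 S mu inv) //.
by apply: eq_bigr => l _; rewrite mulr_sumr.
Qed.

Lemma ave_cst n c : ave n (fun=> c) = c.
Proof.
rewrite /ave -[RHS]mul1r -[in RHS](sum_height_mass S mu inv n) mulr_suml.
apply: eq_bigr => k _; rewrite big_const_nat subn0 iter_addr_0.
by rewrite -mulrA mulr_natl.
Qed.

Local Notation t n := (L%:R * d n).
Local Notation beta := (L%:R ^- 2 : R).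

Lemma sL2_gt0 : 0 < beta.
Proof. by rewrite invr_gt0 exprn_gt0 // ltr0n sL_gt0. Qed.

Lemma sL2_le1 : beta <= 1.
Proof. by rewrite invf_le1 ?exprn_gt0 ?ltr0n ?sL_gt0 // exprn_ege1 // ler1n sL_gt0. Qed.

(* [cexp i n k] is the expected increment of the cocycle over the next [i]
   levels, given that the tower of level [n] is [k]. *)
Fixpoint cexp (i n : nat) : 'I_(C n) -> R :=
  match i with
  | 0 => fun=> 0
  | i'.+1 => fun k => avg n k (fun l j => sres (alpha * j%:R) + cexp i' n.+1 l)
  end.

(** [osc] bounds the oscillation of [cexp] over the towers of one level, [vbound] the sum of squared
    martingale increments, and [oscsum] collects the squares of [osc]. *)
Fixpoint osc (i n : nat) : R :=
  if i is i'.+1 then (1 - beta) * osc i' n.+1 + 2 * t n else 0.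

Fixpoint vbound (i n : nat) : R :=
  if i is i'.+1 then (2 * t n + osc i' n.+1) ^+ 2 + vbound i' n.+1 else 0.

Fixpoint oscsum (i n : nat) : R :=
  if i is i'.+1 then osc i n ^+ 2 + oscsum i' n.+1 else 0.

Lemma oscS i n : osc i.+1 n = (1 - beta) * osc i n.+1 + 2 * t n.
Proof. by []. Qed.

Lemma vboundS i n : vbound i.+1 n = (2 * t n + osc i n.+1) ^+ 2 + vbound i n.+1.
Proof. by []. Qed.

Lemma oscsumS i n : oscsum i.+1 n = osc i.+1 n ^+ 2 + oscsum i n.+1.
Proof. by []. Qed.

Lemma sL_hdist_ge0 n : 0 <= t n.
Proof. by rewrite mulr_ge0 // hdist_ge0. Qed.

Lemma osc_ge0 i n : 0 <= osc i n.
Proof.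
elim: i n => [|i IH] n //=; rewrite addr_ge0 // mulr_ge0 ?sL_hdist_ge0 ?IH //.
by rewrite subr_ge0 sL2_le1.
Qed.

Lemma norm_visit_le n (l : 'I_(C n.+1)) (k : 'I_(C n)) j : (j < h n.+1 l)%N ->
  occurs S n l k j -> `|sres (alpha * j%:R)| <= t n.
Proof.
move=> hj /andP[_ /eqP ho]; rewrite norm_sres.
by have := dnint_visit_le S alpha n _ ho; have [_ ->] := tower_pos S n.+1 l j hj.
Qed.

(** Whatever [k] is, tower [first n.+1] has conditional weight at least [beta], with the same value
    [e0]. So averages over a window of length [osc i n.+1] fall in a window shorter by the factor
    [1 - beta]; the residue adds [t n] on each side. *)
Lemma cexp_osc i n : exists a, forall k : 'I_(C n), a <= cexp i n k <= a + osc i n.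
Proof.
elim: i n => [|i IH] n; first by exists 0 => k; rewrite /= addr0 lexx.
have [a ha] := IH n.+1; set e0 := cexp i n.+1 (first n.+1).
exists (a + beta * (e0 - a) - t n) => k /=.
have [j0 hj0] := occurs_ex S n (first n.+1) k.
have hsplit : avg n k (fun l j => sres (alpha * j%:R) + cexp i n.+1 l) =
    avg n k (fun l j => sres (alpha * j%:R)) + avg n k (fun l j => cexp i n.+1 l).
  exact: avgD.
have b0 := sL2_gt0.
have ht1 : avg n k (fun l j => sres (alpha * j%:R)) <= t n.
  rewrite -[X in _ <= X](avg_cst n k); apply: avg_le => l j hj ho.
  by have := norm_visit_le n l k j hj ho; rewrite ler_norml => /andP[].
have ht2 : - t n <= avg n k (fun l j => sres (alpha * j%:R)).
  rewrite -[X in X <= _](avg_cst n k); apply: avg_le => l j hj ho.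
  by have := norm_visit_le n l k j hj ho; rewrite ler_norml => /andP[].
have hlow : beta * (e0 - a) <= avg n k (fun l j => cexp i n.+1 l) - a.
  have := avg_ge_visit n k (fun l j => cexp i n.+1 l + - a) _ _ (ltn_ord j0) hj0.
  rewrite avgD avg_cst; apply=> l j _ _.
  by rewrite subr_ge0; have /andP[] := ha l.
have hupp : beta * (a + osc i n.+1 - e0) <= a + osc i n.+1 - avg n k (fun l j => cexp i n.+1 l).
  have := avg_ge_visit n k (fun l j => a + osc i n.+1 + (- 1) * cexp i n.+1 l) _ _
    (ltn_ord j0) hj0.
  rewrite avgD avgZ avg_cst !mulN1r; apply=> l j _ _.
  by rewrite mulN1r subr_ge0; have /andP[] := ha l.
rewrite hsplit; move: ht1 ht2 hlow hupp; move: (avg n k _) (avg n k _) (osc _ _) => u v w.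
by move: e0 b0 (t n) => e0 b0 tn; lra.
Qed.

(** [cexp i.+1 n k] is the average of the other two terms, so it lies in the same window of length
    [2 * t n + osc i n.+1] as their sum. *)
Lemma cexp_dev i n (k : 'I_(C n)) l j : (j < h n.+1 l)%N -> occurs S n l k j ->
  `|sres (alpha * j%:R) + cexp i n.+1 l - cexp i.+1 n k| <= 2 * t n + osc i n.+1.
Proof.
move=> hj ho; have [a ha] := cexp_osc i n.+1.
have hin l' j' : (j' < h n.+1 l')%N -> occurs S n l' k j' ->
    a - t n <= sres (alpha * j'%:R) + cexp i n.+1 l' <= a + osc i n.+1 + t n.
  move=> hj' ho'; have := norm_visit_le n l' k j' hj' ho'; have := ha l'.
  by rewrite ler_norml => /andP[? ?] /andP[? ?]; apply/andP; split; lra.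
have h1 : cexp i.+1 n k <= a + osc i n.+1 + t n.
  rewrite /= -[X in _ <= X](avg_cst n k); apply: avg_le => l' j' hj' ho'.
  by have /andP[] := hin l' j' hj' ho'.
have h2 : a - t n <= cexp i.+1 n k.
  rewrite /= -[X in X <= _](avg_cst n k); apply: avg_le => l' j' hj' ho'.
  by have /andP[] := hin l' j' hj' ho'.
have /andP[h3 h4] := hin l j hj ho; rewrite ler_norml; apply/andP; split; lra.
Qed.

(** [rho] plus the expected remaining increment is a martingale. Its increment [D] has conditional
    mean zero and size at most [c], so the second moment grows by at most [c ^+ 2]. *)
Lemma ave_sq_step m n i a : (m <= n)%N ->
  ave n.+1 (fun x => (rho m n.+1 x + cexp i n.+1 (tower n.+1 x) - a) ^+ 2) <=
  ave n (fun x => (rho m n x + cexp i.+1 n (tower n x) - a) ^+ 2) +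
  (2 * t n + osc i n.+1) ^+ 2.
Proof.
move=> hmn; set c := 2 * t n + osc i n.+1; rewrite ave_step -[X in _ + X](ave_cst n).
rewrite /ave -big_split /=; apply: ler_sum => k _; rewrite -big_split /=.
rewrite !big_nat; apply: ler_sum => q /andP[_ hq].
rewrite -mulrDr ler_wpM2l ?mass_ge0 //.
have [k1 k2] := tower_pos S n k q hq; rewrite k1.
set z := rho m n (pos n k q) + _ - a.
pose D l j := sres (alpha * j%:R) + cexp i n.+1 l - cexp i.+1 n k.
have D0 : avg n k D = 0.
  by rewrite /D avgD avg_cst /= subrr.
apply: (@le_trans _ _ (avg n k (fun l j => (z ^+ 2 + c ^+ 2) + 2 * z * D l j))).
  apply: avg_le => l j hj ho.
  have hji := occurs_bound S n l k q j hj ho hq.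
  have [p1 p2] := tower_pos S n.+1 l _ hji.
  move: (ho); rewrite (occurs_shift S n l k q j hji hq) => /andP[/eqP p3 /eqP p4].
  have -> : rho m n.+1 (pos n.+1 l (j + q)) + cexp i n.+1 (tower n.+1 (pos n.+1 l (j + q))) - a =
      z + D l j.
    rewrite p1 /z /D -(rho_const S alpha m n (pos n.+1 l (j + q))) ?k1 ?k2 //.
    have -> : rho m n.+1 (pos n.+1 l (j + q)) = rho m n (pos n.+1 l (j + q)) + sres (alpha * j%:R).
      have -> : sres (alpha * j%:R) = rstep S alpha n (pos n.+1 l (j + q)).
        by rewrite /rstep p2 p4 addnK.
      exact: big_nat_recr.
    by rewrite [cexp i.+1 n k]/=; ring.
  have : `|D l j| <= c := cexp_dev i n k l j hj ho.
  rewrite -(ler_pXn2r (ltn0Sn 1)) ?nnegrE ?normr_ge0 //; last first.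
    by rewrite /c addr_ge0 ?osc_ge0 // mulr_ge0 // sL_hdist_ge0.
  rewrite real_normK ?num_real //; move: (D l j) => w hw.
  have -> : (z + w) ^+ 2 = z ^+ 2 + w ^+ 2 + 2 * z * w by ring.
  by rewrite lerD2r lerD2l.
by rewrite avgD avgZ D0 mulr0 addr0 avg_cst.
Qed.

(** Run the martingale from level [m], where it is within [osc i m] of [a], to level [m + i], where
    no expected increment remains. *)
Lemma ave_rho_le m i : exists a,
  ave (m + i) (fun x => (rho m (m + i) x - a) ^+ 2) <= osc i m ^+ 2 + vbound i m.
Proof.
have [a ha] := cexp_osc i m; exists a.
have key q : (q <= i)%N ->
    ave (m + q) (fun x => (rho m (m + q) x + cexp (i - q) (m + q) (tower (m + q) x) - a) ^+ 2)
    + vbound (i - q) (m + q) <= osc i m ^+ 2 + vbound i m.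
  elim: q => [|q IH] hq.
    rewrite addn0 subn0 lerD2r -[X in _ <= X](ave_cst m).
    apply: ler_sum => k _; apply: ler_sum => j _; rewrite ler_wpM2l ?mass_ge0 //.
    have /andP[h1 h2] := ha (tower m (pos m k j)).
    by rewrite /rho big_geq // add0r ler_pXn2r ?nnegrE ?osc_ge0 //; lra.
  apply: le_trans (IH (ltnW hq)).
  have -> : (i - q)%N = (i - q.+1).+1 by lia.
  rewrite vboundS addrA addnS lerD2r; apply: ave_sq_step; exact: leq_addr.
have := key i (leqnn i); rewrite subnn /= addr0.
congr (_ <= _); apply: eq_bigr => k _; apply: eq_bigr => j _; by rewrite addr0.
Qed.

(** The extra term [(1 - beta) * osc i n ^+ 2] is what the contraction hands over to the next step
    of the induction. *)
Lemma oscsum_le i n :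
  beta * oscsum i n + (1 - beta) * osc i n ^+ 2 <= 4 / beta * \sum_(n <= m < n + i) t m ^+ 2.
Proof.
have b0 := sL2_gt0; have b1 := sL2_le1.
elim: i n => [|i IH] n; first by rewrite /= expr0n /= !mulr0 addr0 big_geq ?mulr0 ?addn0.
rewrite addnS -addSn big_ltn ?leq_addr // oscsumS oscS.
have := IH n.+1; move: (oscsum i n.+1) (osc i n.+1) (\sum_(_ <= _ < _) _) => os w sm.
move: (t n) => tn; move: (beta) b0 b1 => b b0 b1 hIH.
(* Convexity of the square with weights [1 - b] and [b] at the points [w] and [2 * tn / b]. *)
have hA : ((1 - b) * w + 2 * tn) ^+ 2 <= (1 - b) * w ^+ 2 + 4 / b * tn ^+ 2.
  have hsq : 0 <= (1 - b) * b * (w - 2 * tn / b) ^+ 2.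
    apply: mulr_ge0; last exact: sqr_ge0.
    by apply: mulr_ge0; [rewrite subr_ge0|exact: ltW].
  by rewrite -subr_ge0; move: hsq; congr (0 <= _); field; rewrite gt_eqF.
move: hA hIH; move: (4 / b) (((1 - b) * w + 2 * tn) ^+ 2) (w ^+ 2) (tn ^+ 2) => c A w2 t2.
lra.
Qed.

Lemma vbound_le i n :
  vbound i n + 2 * osc i n ^+ 2 <= 8 * \sum_(n <= m < n + i) t m ^+ 2 + 2 * oscsum i n.
Proof.
elim: i n => [|i IH] n; first by rewrite /= big_geq ?addn0 // expr0n /= !mulr0 addr0.
rewrite addnS -addSn big_ltn ?leq_addr //; have := IH n.+1; rewrite vboundS oscsumS.
have : (2 * t n + osc i n.+1) ^+ 2 <= 8 * t n ^+ 2 + 2 * osc i n.+1 ^+ 2.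
  by rewrite -subr_ge0; have := sqr_ge0 (2 * t n - osc i n.+1); lra.
move: (osc i.+1 n) (osc i n.+1) (vbound _ _) (oscsum _ _) (\sum_(_ <= _ < _) _) => a b u v w.
lra.
Qed.

(* The cocycle has square summable conditional oscillations, because averaging over
   a level contracts oscillations by the factor [1 - L^-2]. *)
Lemma ave_rho_bound : exists K : R, 0 < K /\ forall m n, (m <= n)%N -> exists a,
  ave n (fun x => (rho m n x - a) ^+ 2) <= K * \sum_(m <= i < n) d i ^+ 2.
Proof.
have b0 := sL2_gt0.
exists ((8 + 2 * (4 / beta / beta)) * L%:R ^+ 2); split.
  apply: mulr_gt0; last by rewrite exprn_gt0 // ltr0n sL_gt0.
  by apply: addr_gt0 => //; apply: mulr_gt0 => //; apply: divr_gt0 => //; apply: divr_gt0.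
move=> m n /subnKC <-; move: (n - m)%N => i; have [a ha] := ave_rho_le m i.
exists a; apply: le_trans ha _.
have h1 := vbound_le i m; have h2 := oscsum_le i m; have h3 := sqr_ge0 (osc i m).
have e1 : \sum_(m <= q < m + i) t q ^+ 2 = L%:R ^+ 2 * \sum_(m <= q < m + i) d q ^+ 2.
  by rewrite mulr_sumr; apply: eq_bigr => q _; rewrite exprMn.
rewrite e1 in h1 h2.
have h4 : oscsum i m <= 4 / beta / beta * (L%:R ^+ 2 * \sum_(m <= q < m + i) d q ^+ 2).
  rewrite [4 / beta / beta]mulrC -mulrA ler_pdivlMl //; apply: le_trans h2.
  by rewrite lerDl mulr_ge0 // subr_ge0 sL2_le1.
rewrite -[X in _ <= X]mulrA; move: h1 h3 h4.
move: (L%:R ^+ 2 * \sum_(_ <= _ < _) _) (4 / beta / beta) => u v.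
move: (osc i m ^+ 2) (vbound i m) (oscsum i m) => o vb os; lra.
Qed.

End Moments.

(** * Square summability suffices for measurable eigenvalues *)

Section Aperiodicity.
Context {X : ptopologicalType} (S : kr_system X).
Local Notation T := (sT S).
Local Notation Ti := (sTi S).
Local Notation first := (first S).

(** A periodic orbit is finite, hence closed; being dense it would be all of [X], which has no
    isolated point. *)
Lemma aperiodic p x : (0 < p)%N -> iter p T x <> x.
Proof.
move=> p0 hp; have [[[_ hperf] _ haus _] _ hmin] := sys_minimal _ S.
have mulp q : iter (q * p) T x = x.
  by elim: q => // q IH; rewrite mulSn iterD IH.
have modp n : iter n T x = iter (n %% p) T x.
  by rewrite {1}(divn_eq n p) addnC iterD mulp.
have fin_orbit : finite_set [set y | exists2 i, (i < p)%N & y = iter i T x].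
  apply: (@sub_finite_set _ _ [set` [seq iter i T x | i <- iota 0 p]]).
    move=> _ [i hi ->] /=; apply/mapP; exists i => //; by rewrite mem_iota.
  exact: finite_seq.
have sub : two_sided_orbit X T Ti x `<=` [set y | exists2 i, (i < p)%N & y = iter i T x].
  move=> _ [n [->|->]]; first by exists (n %% p)%N; [rewrite ltn_mod|exact: modp].
  (* As [T^(n p)] fixes [x], going back [n] steps is going forward [n * p - n] steps. *)
  exists ((n * p - n) %% p)%N; first by rewrite ltn_mod.
  rewrite -modp; have hn : (n <= n * p)%N by rewrite leq_pmulr.
  rewrite -{1}(mulp n) -{1}(subnKC hn) iterD.
  have iterK q z : iter q Ti (iter q T z) = z.
    by elim: q z => // q IH z; rewrite iterSr /= sTK IH.
  exact: iterK.
have /accessible_finite_set_closed acc := hausdorff_accessible haus.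
have hT : [set: X] = [set y | exists2 i, (i < p)%N & y = iter i T x].
  apply/seteqP; split => // y _.
  have : closure (two_sided_orbit X T Ti x) y by rewrite hmin.
  move=> /(closureS sub); rewrite -(closure_id _).1 //.
  exact: acc.
have : limit_point [set: X] x by rewrite hperf.
have hnb : nbhs x (~` ([set: X] `\ x)).
  apply: open_nbhs_nbhs; split; last by move=> [_ /(_ erefl)].
  apply: closed_openC; apply: acc.
  by apply: sub_finite_set fin_orbit => y _; rewrite -hT.
by move=> /(_ _ hnb) [y [/eqP yx _ hy]]; apply: hy; split.
Qed.

End Aperiodicity.

Section MeasurableSufficiency.
Context {R : realType} {X : ptopologicalType} (S : kr_system X).
Variables (mu : probability (borelX X) R) (alpha : R).
Hypothesis inv : T_invariant R X (sT S) mu.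
Local Notation T := (sT S).
Local Notation C := (sC S).
Local Notation B := (sB S).
Local Notation h := (sh S).
Local Notation tower := (tower S).
Local Notation ret := (ret S).
Local Notation pos := (pos S).
Local Notation first := (first S).
Local Notation d := (hdist S alpha).
Local Notation rho := (rho S alpha).
Local Notation ave := (ave S mu).

Lemma ae_imply2 (P Q W : borelX X -> Prop) : (forall x, P x -> Q x -> W x) ->
  {ae mu, forall x, P x} -> {ae mu, forall x, Q x} -> {ae mu, forall x, W x}.
Proof. by move=> H; apply: (@filterS2 _ _ (ae_filter_ringOfSetsType mu)). Qed.

Lemma ae_imply (P Q : borelX X -> Prop) : (forall x, P x -> Q x) ->
  {ae mu, forall x, P x} -> {ae mu, forall x, Q x}.
Proof. by move=> H; apply: (@filterS _ _ (ae_filter_ringOfSetsType mu)). Qed.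

Lemma ae_not_False : ~ {ae mu, forall x, False}.
Proof.
move=> [A [mA muA hA]]; have : mu setT = 0%E.
  by apply/eqP; rewrite -measure_le0 -muA; apply: le_measure; rewrite ?inE // => x _; exact: hA.
by rewrite probability_setT => /eqP; rewrite onee_eq0.
Qed.

(** The exceptional set [Z] has at most one point, so by aperiodicity its preimages under the powers
    of [T] are disjoint; they have equal measure in a probability space, hence measure zero. *)
Lemma ae_ret_ne0 : {ae mu, forall x, exists n, ret n x <> 0%N}.
Proof.
pose Z : set X := [set x | forall n, ret n x = 0%N].
have [u [hu0 hu]] := ret_ne0_ex S.
have ZE x : Z x -> x = u.
  move=> Zx; apply: contrapT => /eqP /hu [n]; by rewrite Zx.
have mZ : bmeasurable Z.
  have -> : Z = \bigcap_n [set x | ret n x = 0%N].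
    by apply/seteqP; split => x /= H n; [move=> _; exact: H|exact: H].
  by apply: bigcapT_measurable => n; apply: open_bmeasurable; exact: open_ret.
exists Z; split => //; last first.
  by move=> x /= /forallNP H n; apply: contrapT; exact: H.
pose U N : set X := [set x | exists2 j, (j < N)%N & Z (iter j T x)].
have US N : U N.+1 = U N `|` Tinvj X T N Z.
  apply/seteqP; split => x /=.
    by move=> [j]; rewrite ltnS leq_eqVlt => /orP[/eqP ->|hj] Zj; [right|left; exists j].
  by move=> [[j hj Zj]|Zj]; [exists j => //; exact: ltnW|exists N].
have mU N : bmeasurable (U N).
  elim: N => [|N IH]; last first.
    by rewrite US; exact: measurableU _ _ IH (bmeasurable_Tinvj S N Z mZ).
  have -> : U 0 = set0 by apply/seteqP; split => x // [].
  exact: measurable0.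
have muU N : fine (mu (U N : set (borelX X))) = N%:R * fine (mu (Z : set (borelX X))).
  elim: N => [|N IH].
    have -> : U 0 = set0 by apply/seteqP; split => x // [].
    by rewrite measure0 mul0r.
  rewrite US (fadditive_mu mu) ?IH ?(mu_Tinvj S mu inv) //; first 1 last.
  - exact: bmeasurable_Tinvj.
  - apply/seteqP; split => // x /= [[j hj /ZE Zj]] /ZE ZN.
    apply: (aperiodic S (N - j) u); first by rewrite subn_gt0.
    by rewrite -{1}Zj -iterD subnK // ltnW.
  by rewrite -natr1 mulrDl mul1r.
have z0 : 0 <= fine (mu (Z : set (borelX X))) by rewrite fine_ge0.
have fmu (A : set X) : bmeasurable A -> mu (A : set (borelX X)) = (fine (mu (A : set (borelX X))))%:E.
  by move=> mA; rewrite fineK //; exact: fin_num_measure.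
rewrite fmu //; congr EFin; apply/eqP; rewrite eq_le z0 andbT leNgt; apply/negP => zpos.
have := Num.Theory.archi_boundP (ltW (divr_gt0 ltr01 zpos)).
set N := Num.bound _; rewrite ltr_pdivrMr // -muU -lte_fin -fmu //.
by rewrite ltNge probability_le1 //; exact: mU.
Qed.

Lemma level_measurable n (g : X -> R) :
  (forall x y, tower n x = tower n y -> ret n x = ret n y -> g x = g y) ->
  measurable_fun [set: borelX X] (g : borelX X -> R).
Proof.
move=> hg _ Y mY; rewrite setTI; apply: open_bmeasurable.
rewrite openE => x /= Yx; have := near_tower S n x.
by apply: filterS => y [h1 h2] /=; rewrite (hg y x).
Qed.

Lemma level_integrable n (g : X -> R) :
  (forall x y, tower n x = tower n y -> ret n x = ret n y -> g x = g y) ->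
  mu.-integrable [set: borelX X] (EFin \o (g : borelX X -> R)).
Proof.
move=> hg; apply: measurable_bounded_integrable => //.
- by apply: le_lt_trans (probability_le1 mu measurableT) _; rewrite ltry.
- exact: level_measurable hg.
pose G := \sum_(k < C n) \sum_(0 <= j < h n k) `|g (pos n k j)|.
have hG x : `|g x| <= G.
  have [p1 p2] := tower_pos S n (tower n x) (ret n x) (ret_lt S n x).
  rewrite -(hg _ _ p1 p2) /G (bigD1 (tower n x)) //= big_mkord.
  rewrite (bigD1 (Ordinal (ret_lt S n x))) //= -addrA lerDl addr_ge0 // sumr_ge0 // => k _.
  by rewrite sumr_ge0.
exists G; split; first by rewrite num_real.
by move=> r hr x _; apply: le_trans (hG x) (ltW hr).
Qed.

Lemma integral_level n (g : X -> R) :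
  (forall x y, tower n x = tower n y -> ret n x = ret n y -> g x = g y) ->
  (\int[mu]_x (g x)%:E = (ave n g)%:E)%E.
Proof.
move=> hg; have ig := level_integrable n g hg.
pose F (A : set X) : R := \int[mu]_(x in (A : set (borelX X))) g x.
have hF : fadditive F.
  move=> A D mA mD AD; apply: Rintegral_setU => //; last by apply/disj_setPS; rewrite AD.
  by apply: integrableS ig => //; exact: measurableU.
have <- : F setT = ave n g.
  rewrite (fadditive_atoms S F setT n hF measurableT); apply: eq_bigr => k _.
  rewrite !big_nat; apply: eq_bigr => j /andP[_ hj]; rewrite setTI.
  have mA : bmeasurable (Tinvj X T j (B n k)).
    by apply: bmeasurable_Tinvj; exact: bmeasurable_sB.
  rewrite /F (@eq_Rintegral _ _ _ _ _ (fun=> g (pos n k j))) => [|x].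
    by rewrite Rintegral_cst // mass_atom // mulrC.
  rewrite inE => hx; have [x1 x2] := tower_uniq S n k j x hj hx.
  by have [p1 p2] := tower_pos S n k j hj; apply: hg; rewrite ?p1 ?p2 ?x1 ?x2.
by rewrite /F /Rintegral fineK //; exact: integrable_fin_num.
Qed.

Lemma ave_le n (F G : X -> R) : (forall x, F x <= G x) -> ave n F <= ave n G.
Proof.
move=> FG; apply: ler_sum => k _; apply: ler_sum => j _.
by rewrite ler_wpM2l // mass_ge0.
Qed.

Lemma ave_affine n (F : X -> R) a b : ave n (fun x => a + b * F x) = a + b * ave n F.
Proof.
rewrite -[in RHS](ave_cst S mu inv n a) /ave mulr_sumr -big_split /=; apply: eq_bigr => k _.
by rewrite mulr_sumr -big_split /=; apply: eq_bigr => j _; rewrite mulrDr mulrCA.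
Qed.

Lemma tail_small (u : nat -> R) (K : R) : (forall n, 0 <= u n) ->
  (forall N, \sum_(0 <= n < N) u n <= K) -> forall e : R, 0 < e -> exists M, forall m N,
  (M <= m)%N -> (m <= N)%N -> \sum_(m <= n < N) u n <= e.
Proof.
move=> u0 hK e e0.
have [|f hf] := @uniform_series R unit (fun n _ => u n) u K _ hK.
  by move=> m _; rewrite ger0_norm.
have e20 : 0 < e / 2 by rewrite divr_gt0.
have [M hM] := hf (e / 2) e20; exists M => m N hm hN.
have h1 := hM m tt hm; have h2 := hM N tt (leq_trans hm hN).
have h3 : \sum_(0 <= n < N) u n = \sum_(0 <= n < m) u n + \sum_(m <= n < N) u n.
  exact: big_cat_nat.
by move: h1 h2; rewrite h3 !ler_norml; lra.
Qed.

Lemma rho_chasles m n p x : (m <= n)%N -> (n <= p)%N -> rho m p x = rho m n x + rho n p x.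
Proof. by move=> mn np; exact: big_cat_nat. Qed.

(** Levels [M i] are chosen so that the squares beyond [M i] sum to at most [4^-i / K1]. The centred
    increments between consecutive chosen levels then have L1 norm at most [2^-i], so they are
    absolutely summable almost everywhere. *)
Lemma L2_subsequence (K : R) : (forall N, \sum_(0 <= n < N) d n ^+ 2 <= K) ->
  exists (M : nat -> nat) (c : nat -> R), (forall i, (i <= M i)%N) /\
  {ae mu, forall x, exists l : R, (fun i => rho 0 (M i) x - c i) @ \oo --> l}.
Proof.
move=> hK; have [K1 [K10 hK1]] := ave_rho_bound S mu alpha inv.
pose q i : R := 2^-1 ^+ i.
have q0 i : 0 < q i by rewrite exprn_gt0 // invr_gt0.
have /choice [g hg] : forall i, exists M, forall m N, (M <= m)%N -> (m <= N)%N ->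
    \sum_(m <= n < N) d n ^+ 2 <= q i ^+ 2 / K1.
  move=> i; apply: tail_small hK _ _ => [n|]; first exact: sqr_ge0.
  by rewrite divr_gt0 // exprn_gt0.
pose M := fix M i := if i is i'.+1 then maxn (g i) (M i').+1 else g 0%N.
have MS i : (M i < M i.+1)%N by rewrite /= leq_maxr.
have gM i : (g i <= M i)%N by case: i => //= i; exact: leq_maxl.
have iM i : (i <= M i)%N by elim: i => // i IH; exact: leq_ltn_trans IH (MS i).
have /choice [a ha] : forall i, exists a,
    ave (M i.+1) (fun x => (rho (M i) (M i.+1) x - a) ^+ 2) <= q i ^+ 2.
  move=> i; have [a ha] := hK1 (M i) (M i.+1) (ltnW (MS i)); exists a.
  apply: le_trans ha _; rewrite mulrC -ler_pdivlMr //.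
  by apply: hg; [exact: gM|exact: ltnW].
pose y i (x : X) : R := rho (M i) (M i.+1) x - a i.
pose ay i (x : borelX X) : R := `|y i x|.
have ay0 i x : 0 <= ay i x by exact: normr_ge0.
have ylevel i x z : tower (M i.+1) x = tower (M i.+1) z -> ret (M i.+1) x = ret (M i.+1) z ->
    ay i x = ay i z.
  by move=> h1 h2; rewrite /ay /y (rho_const S alpha _ _ x z h1 h2).
have inty i : (\int[mu]_x (ay i x)%:E <= (q i)%:E)%E.
  rewrite (integral_level (M i.+1) (ay i) (ylevel i)) lee_fin.
  (* The first moment is bounded by the second through [w <= q / 2 + w^2 / (2 q)]. *)
  apply: (@le_trans _ _ (ave (M i.+1) (fun x => q i / 2 + (2 * q i)^-1 * y i x ^+ 2))).
    apply: ave_le => x; rewrite /ay -(real_normK (num_real (y i x))); move: `|y i x| => w.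
    have hsq : 0 <= (2 * q i)^-1 * (w - q i) ^+ 2.
      by rewrite mulr_ge0 ?sqr_ge0 // invr_ge0 mulr_ge0 // ltW.
    rewrite -subr_ge0; move: hsq; congr (0 <= _); field; by rewrite gt_eqF.
  rewrite ave_affine; apply: (@le_trans _ _ (q i / 2 + (2 * q i)^-1 * q i ^+ 2)).
    by rewrite lerD2l ler_wpM2l ?ha // invr_ge0 mulr_ge0 // ltW.
  by rewrite le_eqVlt; apply/orP; left; apply/eqP; field; rewrite gt_eqF.
have my i : measurable_fun [set: borelX X] (EFin \o ay i).
  by apply/measurable_EFinP; exact: level_measurable (ylevel i).
pose Y (x : borelX X) := (\sum_(i <oo) (ay i x)%:E)%E.
have mY : measurable_fun [set: borelX X] Y.
  by apply: (@ge0_emeasurable_sum _ _ _ setT (fun i => EFin \o ay i) xpredT) => [i x _ _|//];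
    rewrite lee_fin ay0.
have Y0 x : (0 <= Y x)%E by apply: nneseries_ge0 => i _ _; rewrite lee_fin ay0.
have intY : mu.-integrable [set: borelX X] Y.
  apply/integrableP; split => //.
  rewrite (eq_integral Y) => [|x _]; last by rewrite gee0_abs.
  rewrite integral_nneseries // => [|i x _]; last by rewrite lee_fin ay0.
  apply: (@le_lt_trans _ _ (\sum_(0 <= i <oo) (q i)%:E)%E).
    by apply: lee_nneseries => [i _ _|i _]; [apply: integral_ge0 => x _; rewrite lee_fin ay0|exact: inty].
  apply/nneseries_lt_pinftyP => [i|]; first exact: ltW.
  exists 2 => N; suff -> : \sum_(0 <= i < N) q i = 2 - 2 * q N by rewrite gerBl mulr_ge0 // ltW.
  elim: N => [|N IH]; first by rewrite big_geq // /q expr0; ring.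
  by rewrite big_nat_recr //= IH /q exprS; field.
exists M, (fun i => \sum_(0 <= j < i) a j); split => //.
have := integrable_ae measurableT intY; apply: filterS => x /(_ I) hfin.
have /nneseries_lt_pinftyP [i|Kx hKx] : (\sum_(0 <= i <oo) (ay i x)%:E < +oo)%E => //.
  by rewrite -ge0_fin_numE //; exact: Y0.
have [//|f hf] := @uniform_series R unit (fun i _ => y i x) (ay ^~ x) Kx _ hKx.
have hsum i : rho 0 (M i) x - \sum_(0 <= j < i) a j = rho 0 (M 0) x + \sum_(0 <= j < i) y j x.
  elim: i => [|i IH]; first by rewrite !big_geq // subr0 addr0.
  have e1 : \sum_(0 <= j < i.+1) a j = \sum_(0 <= j < i) a j + a i by exact: big_nat_recr.
  have e2 : \sum_(0 <= j < i.+1) y j x = \sum_(0 <= j < i) y j x + y i x.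
    exact: big_nat_recr.
  have e3 := rho_chasles 0 (M i) (M i.+1) x (leq0n _) (ltnW (MS i)).
  rewrite e1 e2 e3 [in RHS]addrA -IH /y; ring.
exists (rho 0 (M 0) x + f tt); under eq_cvg do rewrite hsum.
apply: cvgD; first exact: cvg_cst.
apply/cvgrPdist_le => e e0; have [N hN] := hf e e0.
by exists N => // n /= hn; exact: hN.
Qed.

Lemma L2_eigenvalue_of_summable (K : R) : (forall N, \sum_(0 <= n < N) d n ^+ 2 <= K) ->
  L2_eigenvalue R X T mu alpha.
Proof.
move=> /L2_subsequence [M [c [iM hae]]].
pose F1 i (x : borelX X) : R := cos (2 * pi * (rho 0 (M i) x - c i)).
pose F2 i (x : borelX X) : R := - sin (2 * pi * (rho 0 (M i) x - c i)).
(* The upper limit is defined and measurable everywhere, and equals the limit wherever the cocycle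
   converges. *)
pose f1 (x : borelX X) : R := limn_sup (F1 ^~ x).
pose f2 (x : borelX X) : R := limn_sup (F2 ^~ x).
have mf1 : measurable_fun setT f1.
  apply: measurable_fun_limn_sup => [x _|x _|i].
  - by exists 1 => _ [i _ <-]; exact: cos_le1.
  - by exists (-1) => _ [i _ <-]; exact: cos_geN1.
  - apply: (level_measurable (M i)) => x z h1 h2.
    by rewrite /F1 (rho_const S alpha _ _ x z h1 h2).
have mf2 : measurable_fun setT f2.
  apply: measurable_fun_limn_sup => [x _|x _|i].
  - by exists 1 => _ [i _ <-]; rewrite lerNl sin_geN1.
  - by exists (-1) => _ [i _ <-]; rewrite lerN2 sin_le1.
  - apply: (level_measurable (M i)) => x z h1 h2.
    by rewrite /F2 (rho_const S alpha _ _ x z h1 h2).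
have lim1 x l : (fun i => rho 0 (M i) x - c i) @ \oo --> l -> f1 x = cos (2 * pi * l).
  move=> hl; apply: (cvg_limn_inf_sup _).2.
  exact: cvg_comp (cvgMr hl) (@continuous_cos R _).
have lim2 x l : (fun i => rho 0 (M i) x - c i) @ \oo --> l -> f2 x = - sin (2 * pi * l).
  move=> hl; apply: (cvg_limn_inf_sup _).2; apply: cvgN.
  exact: cvg_comp (cvgMr hl) (@continuous_sin R _).
have ae1 : {ae mu, forall x, f1 x ^+ 2 + f2 x ^+ 2 = 1}.
  move: hae; apply: ae_imply => x [l hl].
  by rewrite (lim1 _ _ hl) (lim2 _ _ hl) sqrrN cos2Dsin2.
exists f1, f2; split => //.
- rewrite (ae_eq_integral (fun=> 1%:E)) //.
  + rewrite integral_cst // mul1e.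
    by apply: le_lt_trans (probability_le1 mu measurableT) _; rewrite ltry.
  + apply/measurable_EFinP; apply: measurable_funD; exact: measurable_funX.
  + by move: ae1; apply: ae_imply => x /= -> _.
- move=> hz; apply: ae_not_False.
  move: ae1 hz; apply: ae_imply2 => x hx [e1 e2]; move: hx.
  by rewrite e1 e2 expr0n addr0 => /eqP; rewrite eq_sym oner_eq0.
- move: hae ae_ret_ne0; apply: ae_imply2 => x [l hl] hx.
  have [c1 c2] := rho_T_cvg S alpha M c x l iM hx hl.
  have -> : f1 (T x) = cos (2 * pi * (l - alpha)) by apply: (cvg_limn_inf_sup _).2; exact: c1.
  have -> : f2 (T x) = - sin (2 * pi * (l - alpha)).
    by apply: (cvg_limn_inf_sup _).2; apply: cvgN; exact: c2.
  by rewrite (lim1 _ _ hl) (lim2 _ _ hl) mulrBr cosB sinB; split; ring.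
Qed.

End MeasurableSufficiency.

(** * Integrals of eigenfunctions over atoms *)

Section AtomIntegrals.
Context {R : realType} {X : ptopologicalType} (S : kr_system X).
Variables (mu : probability (borelX X) R).
Hypothesis inv : T_invariant R X (sT S) mu.
Local Notation T := (sT S).
Local Notation C := (sC S).
Local Notation B := (sB S).
Local Notation h := (sh S).
Local Notation tower := (tower S).
Local Notation ret := (ret S).
Local Notation first := (first S).
Local Notation BX := (borelX X).
Local Notation integrable f := (mu.-integrable [set: BX] (EFin \o f)).

Definition Int (f : BX -> R) (A : set X) : R := \int[mu]_(x in (A : set BX)) f x.

Lemma integrable_on f (A : set X) : integrable f -> bmeasurable A ->
  mu.-integrable (A : set BX) (EFin \o f).
Proof. by move=> intf mA; apply: integrableS intf. Qed.

Lemma fadditive_Int f : integrable f -> fadditive (Int f).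
Proof.
move=> intf A D mA mD AD; apply: Rintegral_setU => //; last by apply/disj_setPS; rewrite AD.
by apply: integrable_on => //; exact: measurableU.
Qed.

Lemma IntE f (A : set X) : integrable f -> bmeasurable A ->
  (\int[mu]_(x in (A : set BX)) (f x)%:E = (Int f A)%:E)%E.
Proof.
move=> intf mA; rewrite /Int /Rintegral fineK //.
by apply: integrable_fin_num => //; exact: integrable_on.
Qed.

(** Nonnegativity of the variance: integrate [(f - c)^2] with [c] the mean of [f] on [A]. *)
Lemma Int_sq_le f (A : set X) : integrable f -> integrable (fun x => f x ^+ 2) ->
  bmeasurable A -> 0 < fine (mu (A : set BX)) ->
  Int f A ^+ 2 / fine (mu (A : set BX)) <= Int (fun x => f x ^+ 2) A.
Proof.
move=> intf intf2 mA m0; set m := fine _ in m0 *.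
have i1 := integrable_on f A intf mA; have i2 := integrable_on _ A intf2 mA.
have ic (c : R) : mu.-integrable (A : set BX) (EFin \o (fun=> c)).
  by apply: integrable_on => //; exact: finite_measure_integrable_cst.
set c := Int f A / m.
have iz : mu.-integrable (A : set BX) (EFin \o (fun x => (- (2 * c)) * f x)).
  by apply: (integrableZl mA (- (2 * c)) i1).
have e : Int (fun x => (f x - c) ^+ 2) A = Int (fun x => f x ^+ 2) A - 2 * c * Int f A + c ^+ 2 * m.
  rewrite /Int (@eq_Rintegral _ _ _ _ _ (fun x => f x ^+ 2 + ((- (2 * c)) * f x + c ^+ 2))).
    rewrite RintegralD //; last exact: (integrableD mA iz (ic (c ^+ 2))).
    by rewrite RintegralD // RintegralZl // Rintegral_cst // -/m mulNr addrA.
  by move=> x _ /=; ring.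
have : 0 <= Int (fun x => (f x - c) ^+ 2) A by apply: Rintegral_ge0 => x _; exact: sqr_ge0.
rewrite e => he; rewrite -subr_ge0; move: he; congr (0 <= _); rewrite /c; field.
by rewrite gt_eqF.
Qed.

Let mT : measurable_fun [set: BX] (T : BX -> BX).
Proof. by move=> _ A mA; rewrite setTI; exact: bmeasurable_T. Qed.

Let Tm : {mfun BX >-> BX} :=
  HB.pack (T : BX -> BX) (isMeasurableFun.Build _ _ _ _ _ mT).

Let pushE (D : set BX) (f : BX -> \bar R) :
  (\int[pushforward mu (T : BX -> BX)]_(x in D) f x = \int[mu]_(x in D) f x)%E.
Proof.
rewrite (@eq_measure_integral _ _ _ D mu (pushforward mu Tm) f) //.
by move=> A mA _; exact: inv.
Qed.

Lemma integrable_compT f : measurable_fun [set: BX] f -> integrable f ->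
  integrable (fun x => f (T x)).
Proof.
move=> mf /integrableP[_ fin]; apply/integrableP; split.
  by apply/measurable_EFinP; exact: measurableT_comp mf mT.
move: fin; congr (_ < _)%E; rewrite -pushE ge0_integral_pushforward //.
by apply: measurableT_comp => //; apply/measurable_EFinP.
Qed.

Lemma Int_compT f (A : set X) : measurable_fun [set: BX] f -> integrable f ->
  bmeasurable A -> Int (fun x => f (T x)) (T @^-1` A) = Int f A.
Proof.
move=> mf intf mA; rewrite /Int /Rintegral; congr fine; rewrite -[RHS]pushE.
rewrite (integral_pushforward mT) //; first exact/measurable_EFinP.
apply: (integrable_on (fun x => f (T x))); first exact: integrable_compT.
exact: bmeasurable_T.
Qed.

Lemma tower_coarsen_le m n x y : (m <= n)%N -> tower n x = tower n y ->
  ret n x = ret n y -> tower m x = tower m y /\ ret m x = ret m y.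
Proof.
move=> /subnK <-; elim: (n - m)%N => // i IH h1 h2.
by have [h3 h4] := tower_coarsen S _ _ _ h1 h2; exact: IH.
Qed.

(** The empty set makes the family stable under intersection: two atoms are nested or disjoint. *)
Let atoms : set (set X) :=
  [set A | A = set0 \/ exists n (k : 'I_(C n)) j, (j < h n k)%N /\ A = Tinvj X T j (B n k)].

Lemma atoms_setI_closed : setI_closed atoms.
Proof.
have key n m (k : 'I_(C n)) (k' : 'I_(C m)) j j' : (n <= m)%N -> (j < h n k)%N ->
    (j' < h m k')%N -> atoms (Tinvj X T j (B n k) `&` Tinvj X T j' (B m k')).
  move=> nm hj hj'.
  have [[x [x1 x2]]|no] := pselect ((Tinvj X T j (B n k) `&` Tinvj X T j' (B m k')) !=set0).
    right; exists m, k', j'; split => //; apply/seteqP; split => y /=; first by case.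
    move=> hy; split => //.
    have [a1 a2] := tower_uniq S _ _ _ _ hj x1; have [b1 b2] := tower_uniq S _ _ _ _ hj' x2.
    have [c1 c2] := tower_uniq S _ _ _ _ hj' hy.
    have [|| e1 e2] := tower_coarsen_le n m y x nm; rewrite ?b1 ?b2 ?c1 ?c2 //.
    by rewrite -a1 -a2 -e1 -e2; exact: tower_mem.
  by left; apply/seteqP; split => y // hy; case: no; exists y.
move=> A D [->|[n [k [j [hj ->]]]]]; first by rewrite set0I; left.
move=> [->|[m [k' [j' [hj' ->]]]]]; first by rewrite setI0; left.
have [nm|/ltnW mn] := leqP n m; first exact: key.
by rewrite setIC; exact: key.
Qed.

(** By (KR4) an open set is the union of the atoms it contains, and there are countably many
    atoms. *)
Lemma borel_atoms : @measurable _ BX = <<s atoms >>.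
Proof.
apply/seteqP; split; last first.
  apply: smallest_sub; first exact: sigma_algebra_measurable.
  move=> A [->|[n [k [j [hj ->]]]]]; first exact: measurable0.
  by apply: open_bmeasurable; exact: open_atom.
apply: smallest_sub; first exact: smallest_sigma_algebra.
move=> U oU.
(* Each [A n i j] is an atom or empty, in particular for indices out of range; natural numbers as
   indices make the unions countable. *)
pose A (n i j : nat) : set X := [set x | [/\ nat_of_ord (tower n x) = i, ret n x = j &
  forall y, tower n y = tower n x -> ret n y = ret n x -> U y]].
have UE : U = \bigcup_n \bigcup_i \bigcup_j A n i j.
  apply/seteqP; split => x; last by move=> [n _ [i _ [j _ [_ _ H]]]]; exact: H.
  move=> Ux; have [_ _ _ _ [_ H _ _ _]] := sys_KR _ S.
  have [n [D [[k [j [hj ->]]] Dx DU]]] := H U x oU Ux.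
  have [x1 x2] := tower_uniq S _ _ _ _ hj Dx.
  exists n => //; exists (nat_of_ord (tower n x)) => //; exists (ret n x) => //.
  split => // y y1 y2; apply: DU; rewrite /Tinvj /= -x1 -x2 -y1 -y2; exact: tower_mem.
have mA n i j : <<s atoms >> (A n i j).
  have [[x [x1 x2 x3]]|no] := pselect (A n i j !=set0); last first.
    have -> : A n i j = set0 by apply/seteqP; split => y // hy; case: no; exists y.
    by apply: sub_sigma_algebra; left.
  apply: sub_sigma_algebra; right; exists n, (tower n x), (ret n x).
  split; first exact: ret_lt.
  apply/seteqP; split => y /=.
    move=> [y1 y2 _]; rewrite /Tinvj /= x2 -y2.
    have -> : tower n x = tower n y by apply: val_inj; rewrite /= x1 y1.
    exact: tower_mem.
  move=> hy; have [y1 y2] := tower_uniq S _ _ _ _ (ret_lt S n x) hy.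
  by split; rewrite ?y1 ?y2.
have bigU (F : nat -> set X) : (forall i, <<s atoms >> (F i)) -> <<s atoms >> (\bigcup_i F i).
  by move=> HF; apply: (@bigcupT_measurable _ (g_sigma_algebraType atoms)).
rewrite UE; apply: (bigU (fun n => \bigcup_i \bigcup_j A n i j)) => n.
apply: (bigU (fun i => \bigcup_j A n i j)) => i; exact: (bigU (A n i)).
Qed.

(** Sets over which [f] has integral zero form a Dynkin class containing the atoms, which are stable
    under intersection and generate the Borel sets. *)
Lemma ae_eq0_of_atoms f : integrable f ->
  (forall n (k : 'I_(C n)) j, (j < h n k)%N -> Int f (Tinvj X T j (B n k)) = 0) ->
  {ae mu, forall x, f x = 0}.
Proof.
move=> intf H.
have IT : Int f setT = 0.
  rewrite (fadditive_atoms S (Int f) setT 0 (fadditive_Int f intf) measurableT) big1 // => k _.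
  by rewrite big_nat big1 // => j /andP[_ hj]; rewrite setTI H.
have all0 (A : set BX) : measurable A -> Int f A = 0.
  rewrite {1}borel_atoms; move: A; apply: (dynkin_induction borel_atoms) => //.
  - exact: atoms_setI_closed.
  - move=> A [->|[n [k [j [hj ->]]]]]; last exact: H.
    exact: fadditive_set0 (fadditive_Int f intf).
  - move=> A mA IA; have := fadditive_Int f intf A (~` A) mA (measurableC mA) (setICr A).
    by rewrite setUCr IT IA add0r.
  - move=> F mF tF IF; rewrite /Int /Rintegral integral_bigcup //; last first.
      by apply: (integrable_on f) => //; exact: bigcupT_measurable.
    by rewrite eseries0 // => i _ _; have := IntE f (F i) intf (mF i); rewrite IF.
have := @integral_ae_eq _ _ _ mu setT measurableT (cst 0%E) (EFin \o f) intf.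
move=> /(_ (@measurable_cst _ _ _ _ _ _)) [].
  by move=> E _ mE; rewrite integral0 (IntE f) // all0.
move=> N [mN muN hN]; exists N; split => // x /= hx; apply: hN => /= he; apply: hx.
by have := he I => -[].
Qed.

End AtomIntegrals.

(** * Square summability is necessary for measurable eigenvalues *)

Section Energy.
Context {R : realType} {X : ptopologicalType} (S : kr_system X).
Variables (mu : probability (borelX X) R) (alpha : R).
Hypothesis inv : T_invariant R X (sT S) mu.
Variables f1 f2 : borelX X -> R.
Hypothesis mf1 : measurable_fun [set: borelX X] f1.
Hypothesis mf2 : measurable_fun [set: borelX X] f2.
Hypothesis f_L2 : (\int[mu]_x ((f1 x) ^+ 2 + (f2 x) ^+ 2)%:E < +oo)%E.
Hypothesis f_ne0 : ~ {ae mu, forall x, f1 x = 0 /\ f2 x = 0}.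
Hypothesis f_eigen : {ae mu, forall x,
  f1 (sT S x) = cos (2 * pi * alpha) * f1 x - sin (2 * pi * alpha) * f2 x /\
  f2 (sT S x) = sin (2 * pi * alpha) * f1 x + cos (2 * pi * alpha) * f2 x}.
Local Notation T := (sT S).
Local Notation Ti := (sTi S).
Local Notation C := (sC S).
Local Notation B := (sB S).
Local Notation h := (sh S).
Local Notation tower := (tower S).
Local Notation ret := (ret S).
Local Notation first := (first S).
Local Notation L := (sL S).
Local Notation d := (hdist S alpha).
Local Notation mass := (mass S mu).
Local Notation avg := (avg S mu).
Local Notation Int := (Int mu).
Local Notation BX := (borelX X).
Local Notation integrable f := (mu.-integrable [set: BX] (EFin \o f)).
Local Notation co j := (cos (2 * pi * (alpha * j%:R))).
Local Notation si j := (sin (2 * pi * (alpha * j%:R))).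

Let mf12 : measurable_fun [set: BX] (fun x => f1 x ^+ 2 + f2 x ^+ 2).
Proof. by apply: measurable_funD; exact: measurable_funX. Qed.

Let if12 : integrable (fun x => f1 x ^+ 2 + f2 x ^+ 2).
Proof.
apply/integrableP; split; first by apply/measurable_EFinP; exact: mf12.
move: f_L2; congr (_ < _)%E; apply: eq_integral => x _ /=.
by rewrite ger0_norm // addr_ge0 // sqr_ge0.
Qed.

Let le_sq_integrable (f : BX -> R) : measurable_fun [set: BX] f ->
  (forall x, f x ^+ 2 <= f1 x ^+ 2 + f2 x ^+ 2) ->
  integrable f /\ integrable (fun x => f x ^+ 2).
Proof.
move=> mf hf.
have i2 : integrable (fun x => f x ^+ 2).
  apply: (le_integrable measurableT _ _ if12).
    by apply/measurable_EFinP; exact: measurable_funX.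
  move=> x _ /=; rewrite lee_fin !ger0_norm ?sqr_ge0 ?addr_ge0 ?sqr_ge0 //; exact: hf.
split => //; have i1 : integrable (fun x : BX => 1 + f x ^+ 2).
  apply: (integrableD measurableT (f := EFin \o (fun=> 1)) _ i2).
  exact: finite_measure_integrable_cst.
apply: (le_integrable measurableT _ _ i1); first exact/measurable_EFinP.
move=> x _ /=; rewrite lee_fin [X in _ <= X]ger0_norm; last by rewrite addr_ge0 ?sqr_ge0.
have := sqr_ge0 (f x - 1); have := sqr_ge0 (f x + 1); move: (f x) => y h1 h2.
by rewrite ler_norml; apply/andP; split; nra.
Qed.

Let if1 : integrable f1.
Proof. by apply: (le_sq_integrable f1 mf1 _).1 => x; rewrite lerDl sqr_ge0. Qed.

Let if2 : integrable f2.
Proof. by apply: (le_sq_integrable f2 mf2 _).1 => x; rewrite lerDr sqr_ge0. Qed.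

Let if1s : integrable (fun x => f1 x ^+ 2).
Proof. by apply: (le_sq_integrable f1 mf1 _).2 => x; rewrite lerDl sqr_ge0. Qed.

Let if2s : integrable (fun x => f2 x ^+ 2).
Proof. by apply: (le_sq_integrable f2 mf2 _).2 => x; rewrite lerDr sqr_ge0. Qed.

Let Int_lin (f : BX -> R) a b (A : set X) : measurable_fun [set: BX] f -> integrable f ->
  {ae mu, forall x, f (T x) = a * f1 x + b * f2 x} -> bmeasurable A ->
  Int f A = a * Int f1 (T @^-1` A) + b * Int f2 (T @^-1` A).
Proof.
move=> mf intf hf mA; rewrite -(Int_compT S mu inv f A) //.
have mTA : bmeasurable (T @^-1` A) by exact: bmeasurable_T.
have j1 := integrable_on mu f1 _ if1 mTA; have j2 := integrable_on mu f2 _ if2 mTA.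
have k1 : mu.-integrable (T @^-1` A : set BX) (EFin \o (fun x => a * f1 x)).
  exact: (integrableZl mTA a j1).
have k2 : mu.-integrable (T @^-1` A : set BX) (EFin \o (fun x => b * f2 x)).
  exact: (integrableZl mTA b j2).
rewrite -(@RintegralZl _ _ _ mu) // -(@RintegralZl _ _ _ mu _ f2) // -RintegralD //.
have j3 := integrable_on mu _ _ (integrable_compT S mu inv f mf intf) mTA.
have k3 := integrableD mTA k1 k2.
rewrite /Int /Rintegral; congr fine; apply: ae_eq_integral => //.
- by case/integrableP: j3.
- by case/integrableP: k3.
- by move: hf; apply: ae_imply => x /= -> _.
Qed.

(** Integrating [f o T = lambda f] over [T^-1 A] gives [Int f A = lambda * Int f (T^-1 A)]; multiply
    by the conjugate of [lambda]. *)
Lemma Int_T (A : set X) : bmeasurable A ->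
  Int f1 (T @^-1` A) = cos (2 * pi * alpha) * Int f1 A + sin (2 * pi * alpha) * Int f2 A /\
  Int f2 (T @^-1` A) = - sin (2 * pi * alpha) * Int f1 A + cos (2 * pi * alpha) * Int f2 A.
Proof.
move=> mA.
have e1 := Int_lin f1 (cos (2 * pi * alpha)) (- sin (2 * pi * alpha)) A mf1 if1.
have e2 := Int_lin f2 (sin (2 * pi * alpha)) (cos (2 * pi * alpha)) A mf2 if2.
rewrite {}e1 //; last by move: f_eigen; apply: ae_imply => x [-> _]; rewrite mulNr.
rewrite {}e2 //; last by move: f_eigen; apply: ae_imply => x [_ ->].
have := cos2Dsin2 (2 * pi * alpha).
move: (cos _) (sin _) (Int f1 _) (Int f2 _) => c s u v hcs.
split; first by rewrite -[LHS]mul1r -hcs; ring.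
by rewrite -[LHS]mul1r -hcs; ring.
Qed.

Lemma Int_Tinvj j (A : set X) : bmeasurable A ->
  Int f1 (Tinvj X T j A) = co j * Int f1 A + si j * Int f2 A /\
  Int f2 (Tinvj X T j A) = - si j * Int f1 A + co j * Int f2 A.
Proof.
move=> mA; elim: j => [|j [IH1 IH2]].
  by rewrite !mulr0 cos0 sin0 oppr0 !mul1r !mul0r addr0 add0r.
rewrite TinvjS; have [-> ->] := Int_T _ (bmeasurable_Tinvj S j A mA); rewrite IH1 IH2.
have -> : 2 * pi * (alpha * j.+1%:R) = 2 * pi * (alpha * j%:R) + 2 * pi * alpha.
  by rewrite -natr1; ring.
by rewrite cosD sinD; split; ring.
Qed.

Definition mean1 n (k : 'I_(C n)) : R := Int f1 (B n k) / mass n k.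
Definition mean2 n (k : 'I_(C n)) : R := Int f2 (B n k) / mass n k.

Definition sqn n (k : 'I_(C n)) : R := mean1 n k ^+ 2 + mean2 n k ^+ 2.

(** The squared L2 norm of the conditional expectation of [f] given the partition of level [n],
    whose modulus is constant along each tower. *)
Definition energy n : R := \sum_(k < C n) (h n k)%:R * mass n k * sqn n k.

Lemma mean1_avg n (k : 'I_(C n)) :
  mean1 n k = avg n k (fun l j => co j * mean1 n.+1 l + si j * mean2 n.+1 l).
Proof.
rewrite /mean1 (fadditive_sB S (Int f1) n k (fadditive_Int mu f1 if1)); congr (_ / _).
apply: eq_bigr => l _; apply: eq_bigr => j _.
have [-> _] := Int_Tinvj j _ (bmeasurable_sB S n.+1 l); rewrite /mean2; field.
by rewrite gt_eqF // (mass_gt0 S mu inv).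
Qed.

Lemma mean2_avg n (k : 'I_(C n)) :
  mean2 n k = avg n k (fun l j => - si j * mean1 n.+1 l + co j * mean2 n.+1 l).
Proof.
rewrite /mean2 (fadditive_sB S (Int f2) n k (fadditive_Int mu f2 if2)); congr (_ / _).
apply: eq_bigr => l _; apply: eq_bigr => j _.
have [_ ->] := Int_Tinvj j _ (bmeasurable_sB S n.+1 l); rewrite /mean1; field.
by rewrite gt_eqF // (mass_gt0 S mu inv).
Qed.

(** The squared modulus of the martingale increment on [T^-j B_l(n+1)], when this atom is inside
    [B_k(n)]. *)
Definition dev n (k : 'I_(C n)) (l : 'I_(C n.+1)) (j : nat) : R :=
  (co j * mean1 n.+1 l + si j * mean2 n.+1 l - mean1 n k) ^+ 2 +
  (- si j * mean1 n.+1 l + co j * mean2 n.+1 l - mean2 n k) ^+ 2.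

(** Pythagoras: martingale increments are orthogonal to the past. *)
Lemma energyS n : energy n.+1 - energy n =
  \sum_(k < C n) (h n k)%:R * mass n k * avg n k (dev n k).
Proof.
have -> : energy n.+1 = \sum_(k < C n) (h n k)%:R * mass n k * avg n k (fun l _ => sqn n.+1 l).
  rewrite /energy; under eq_bigr do rewrite -mulrA height_rec mulr_suml.
  rewrite exchange_big /=; apply: eq_bigr => k _.
  rewrite -mulrA /avg [mass n k * _]mulrC divfK; last by rewrite gt_eqF // (mass_gt0 S mu inv).
  rewrite mulr_sumr; apply: eq_bigr => l _; rewrite mulr_suml mulr_sumr.
  by apply: eq_bigr => j _.
rewrite /energy -sumrB; apply: eq_bigr => k _; rewrite -mulrBr; congr (_ * _).
set F := fun l j => co j * mean1 n.+1 l + si j * mean2 n.+1 l.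
set G := fun l j => - si j * mean1 n.+1 l + co j * mean2 n.+1 l.
have -> : avg n k (dev n k) = avg n k (fun l j => (sqn n.+1 l + sqn n k) +
    ((- (2 * mean1 n k)) * F l j + (- (2 * mean2 n k)) * G l j)).
  rewrite /avg; congr (_ / _); apply: eq_bigr => l _; apply: eq_bigr => j _; congr (_ * _).
  have hcs := cos2Dsin2 (2 * pi * (alpha * j%:R)); rewrite /dev /sqn /F /G.
  move: (cos _) (sin _) hcs (mean1 n.+1 l) (mean2 n.+1 l) (mean1 n k) (mean2 n k) => c s hcs x y z w.
  transitivity ((c ^+ 2 + s ^+ 2) * (x ^+ 2 + y ^+ 2) + (z ^+ 2 + w ^+ 2) +
    ((- (2 * z)) * (c * x + s * y) + (- (2 * w)) * (- s * x + c * y))); first by ring.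
  by rewrite hcs; ring.
have eF : avg n k F = mean1 n k by rewrite mean1_avg.
have eG : avg n k G = mean2 n k by rewrite mean2_avg.
rewrite (avgD S mu n k (fun l _ => sqn n.+1 l + sqn n k)
  (fun l j => - (2 * mean1 n k) * F l j + - (2 * mean2 n k) * G l j)).
rewrite (avgD S mu n k (fun l _ => sqn n.+1 l) (fun _ _ => sqn n k)).
rewrite (avgD S mu n k (fun l j => - (2 * mean1 n k) * F l j) (fun l j => - (2 * mean2 n k) * G l j)).
rewrite (avgZ S mu n k _ F) (avgZ S mu n k _ G) eF eG (avg_cst S mu inv).
rewrite [sqn n k]/sqn; move: (avg n k _) => u; ring.
Qed.

Lemma avg_dev_ge0 n (k : 'I_(C n)) : 0 <= avg n k (dev n k).
Proof.
rewrite -[X in X <= _](avg_cst S mu inv n k); apply: avg_le => l j _ _.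
by rewrite addr_ge0 // sqr_ge0.
Qed.

Lemma energy_le_S n : energy n <= energy n.+1.
Proof.
rewrite -subr_ge0 energyS sumr_ge0 // => k _.
by rewrite mulr_ge0 ?avg_dev_ge0 // mulr_ge0 // mass_ge0.
Qed.

(** A single [dev] has weight at least [L^-3] in the energy increment: [L^-2] from [avg_ge_visit]
    and [L^-1] from [height_mass_ge]. *)
Definition gap n : R := L%:R ^+ 3 * (energy n.+1 - energy n).

Lemma gap_ge0 n : 0 <= gap n.
Proof. by rewrite mulr_ge0 ?exprn_ge0 // subr_ge0 energy_le_S. Qed.

Lemma dev_le_gap n y : ret n y = 0%N ->
  dev n (tower n y) (tower n.+1 y) (ret n.+1 y) <= gap n.
Proof.
move=> h0; set k := tower n y; set l := tower n.+1 y; set j := ret n.+1 y.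
have hj : (j < h n.+1 l)%N by exact: ret_lt.
have ho : occurs S n l k j by rewrite occursP // h0 !eqxx.
have h1 : L%:R ^- 2 * dev n k l j <= avg n k (dev n k).
  by apply: (avg_ge_visit S mu inv) => // l' j' _ _; rewrite addr_ge0 // sqr_ge0.
have h2 : (h n k)%:R * mass n k * avg n k (dev n k) <= energy n.+1 - energy n.
  rewrite energyS (bigD1 k) //= lerDl sumr_ge0 // => k' _.
  by rewrite mulr_ge0 ?avg_dev_ge0 // mulr_ge0 // mass_ge0.
have L0 : 0 < L%:R :> R by rewrite ltr0n sL_gt0.
have h3 := height_mass_ge S mu inv n k.
have h4 : avg n k (dev n k) <= L%:R * (energy n.+1 - energy n).
  apply: (@le_trans _ _ (L%:R * ((h n k)%:R * mass n k) * avg n k (dev n k))).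
    by rewrite ler_peMl // avg_dev_ge0.
  by rewrite -mulrA ler_wpM2l // ltW.
have := le_trans h1 h4; rewrite ler_pdivrMl ?exprn_gt0 // => h5.
by apply: le_trans h5 _; rewrite /gap mulrA -exprSr.
Qed.

(** Conditional expectation does not increase the L2 norm; here atom by atom, from [Int_sq_le]. *)
Lemma energy_le n : energy n <= Int (fun x => f1 x ^+ 2) setT + Int (fun x => f2 x ^+ 2) setT.
Proof.
rewrite (fadditive_atoms S _ setT n (fadditive_Int mu _ if1s) measurableT).
rewrite (fadditive_atoms S _ setT n (fadditive_Int mu _ if2s) measurableT).
rewrite -big_split /=; apply: ler_sum => k _; rewrite -big_split /=.
have -> : (h n k)%:R * mass n k * sqn n k = \sum_(0 <= j < h n k) mass n k * sqn n k.
  by rewrite big_const_nat subn0 iter_addr_0 -mulrA mulr_natl.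
rewrite !big_nat; apply: ler_sum => j _; rewrite !setTI.
have mB := bmeasurable_sB S n k; have mA := bmeasurable_Tinvj S j _ mB.
have m0 := mass_gt0 S mu inv n k.
have mE : fine (mu (Tinvj X T j (B n k) : set BX)) = mass n k by exact: mass_atom.
have c1 := Int_sq_le mu f1 _ if1 if1s mA; have c2 := Int_sq_le mu f2 _ if2 if2s mA.
rewrite mE in c1 c2; apply: le_trans (lerD (c1 m0) (c2 m0)).
have [-> ->] := Int_Tinvj j _ mB; rewrite le_eqVlt; apply/orP; left; apply/eqP.
have := cos2Dsin2 (2 * pi * (alpha * j%:R)); rewrite /sqn /mean1 /mean2.
move: (cos _) (sin _) (Int f1 _) (Int f2 _) => c s u v hcs.
transitivity ((c ^+ 2 + s ^+ 2) * (u ^+ 2 + v ^+ 2) / mass n k); last by field; rewrite gt_eqF.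
by rewrite hcs; field; rewrite gt_eqF.
Qed.

Lemma sum_gap N : \sum_(0 <= n < N) gap n <=
  L%:R ^+ 3 * (Int (fun x => f1 x ^+ 2) setT + Int (fun x => f2 x ^+ 2) setT).
Proof.
rewrite -mulr_sumr telescope_sumr // ler_wpM2l ?exprn_ge0 //.
apply: le_trans (energy_le N); rewrite gerBl sumr_ge0 // => k _.
by rewrite mulr_ge0 ?addr_ge0 ?sqr_ge0 // mulr_ge0 // mass_ge0.
Qed.

Lemma energy_gt0 : exists n, 0 < energy n.
Proof.
apply: contrapT => /forallNP H; apply: f_ne0.
have sq0 n (k : 'I_(C n)) : sqn n k = 0.
  have s0 (k' : 'I_(C n)) : 0 <= (h n k')%:R * mass n k' * sqn n k'.
    by rewrite mulr_ge0 ?addr_ge0 ?sqr_ge0 // mulr_ge0 // mass_ge0.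
  have e0 : energy n = 0.
    apply/eqP; rewrite eq_le sumr_ge0 ?andbT; last by move=> k' _; exact: s0.
    by rewrite leNgt; apply/negP; exact: H.
  have /eqP := psumr_eq0P (fun k' _ => s0 k') e0 (i := k) isT; rewrite !mulf_eq0.
  by rewrite pnatr_eq0 gtn_eqF ?h_gt0 // gt_eqF ?(mass_gt0 S mu inv) //= => /eqP.
have I0 n (k : 'I_(C n)) : Int f1 (B n k) = 0 /\ Int f2 (B n k) = 0.
  have /eqP := sq0 n k; rewrite paddr_eq0 ?sqr_ge0 // !sqrf_eq0 => /andP[/eqP z1 /eqP z2].
  have m0 : mass n k != 0 by rewrite gt_eqF // (mass_gt0 S mu inv).
  by rewrite -(divfK m0 (Int f1 _)) -(divfK m0 (Int f2 _)) -/(mean1 n k) -/(mean2 n k) z1 z2 mul0r.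
have z1 : {ae mu, forall x, f1 x = 0}.
  apply: (ae_eq0_of_atoms S mu f1 if1) => n k j _.
  have [-> _] := Int_Tinvj j _ (bmeasurable_sB S n k); have [-> ->] := I0 n k.
  by rewrite !mulr0 addr0.
have z2 : {ae mu, forall x, f2 x = 0}.
  apply: (ae_eq0_of_atoms S mu f2 if2) => n k j _.
  have [_ ->] := Int_Tinvj j _ (bmeasurable_sB S n k); have [-> ->] := I0 n k.
  by rewrite !mulr0 addr0.
by move: z1 z2; apply: ae_imply2 => x -> ->.
Qed.

(** The case [j = 0] of [dev_le_gap]: by (KR6) the top floor of every tower lies in the first base
    of the level before. *)
Lemma first_gap n (l : 'I_(C n.+1)) :
  (mean1 n.+1 l - mean1 n (first n)) ^+ 2 + (mean2 n.+1 l - mean2 n (first n)) ^+ 2 <= gap n.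
Proof.
have [p1 p2] := tower_pos S n.+1 l 0 (h_gt0 S n.+1 l).
have [q1 q2] := ret_first S n _ p2.
have := dev_le_gap n _ q2; rewrite p1 p2 q1 /dev !mulr0 cos0 sin0.
by rewrite oppr0 !mul1r !mul0r addr0 add0r.
Qed.

Lemma energy_mono m n : (m <= n)%N -> energy m <= energy n.
Proof.
move=> /subnK <-; elim: (n - m)%N => // i IH.
by rewrite addSn; apply: le_trans IH (energy_le_S _).
Qed.

Lemma gap_small e : 0 < e -> exists N, forall n, (N <= n)%N -> gap n <= e.
Proof.
move=> e0; have [N HN] := tail_small gap _ gap_ge0 sum_gap e e0.
by exists N => n hn; have := HN n n.+1 hn (leqnSn n); rewrite big_nat1.
Qed.

Lemma sqn_lower : exists c N, 0 < c /\ forall n (k : 'I_(C n)), (N <= n)%N -> c <= sqn n k.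
Proof.
have [n0 e0] := energy_gt0.
have e16 : 0 < energy n0 / 16 by rewrite divr_gt0.
have [N HN] := gap_small _ e16.
(* Two means of the same level are within [2 * sqrt (energy n0 / 16)] of each other, and one has
   modulus at least [sqrt (energy n0)]; half of it is left for the other. *)
exists (energy n0 / 4), (maxn n0 N).+1; split; first by rewrite divr_gt0.
move=> [//|n] l; rewrite ltnS geq_max => /andP[hn0 hN].
have [k hk] : exists k : 'I_(C n.+1), energy n0 <= sqn n.+1 k.
  apply: contrapT => /forallNP H.
  have : energy n.+1 < energy n0.
    rewrite -[X in _ < X]mul1r -[in X in _ < X](sum_height_mass S mu inv n.+1) mulr_suml.
    apply: ltr_sum; first by apply/hasP; exists (first n.+1); rewrite ?mem_index_enum.
    move=> k _; rewrite ltr_pM2l; first by rewrite ltNge; apply/negP; exact: H.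
    by rewrite mulr_gt0 ?ltr0n ?h_gt0 // (mass_gt0 S mu inv).
  by rewrite ltNge energy_mono // (leq_trans hn0).
have g1 := first_gap n l; have g2 := first_gap n k; have g3 := HN n hN.
move: hk g1 g2; rewrite /sqn.
move: (mean1 n.+1 k) (mean2 n.+1 k) (mean1 n.+1 l) (mean2 n.+1 l) (mean1 n _) (mean2 n _) => x y z w u v hk g1 g2.
have s1 := sqr_ge0 (2 * z - x); have s2 := sqr_ge0 (2 * w - y).
have s3 := sqr_ge0 (z - u + (x - u)); have s4 := sqr_ge0 (w - v + (y - v)).
nra.
Qed.

(** With [l] the tower and [j] the depth of [y] at level [n.+2], four small steps lead from
    [lambda^-j a_(n+2)(l)] back to [a_(n+2)(l)]: via the mean of the visited tower, the first mean
    of level [n] and the first mean of level [n.+1]. As [a_(n+2)(l)] stays away from zero,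
    [lambda^j] is close to 1. *)
Lemma visit_gap : exists K N, 0 <= K /\ forall n y, (N <= n)%N -> ret n.+1 y = 0%N ->
  dnint (alpha * (ret n.+2 y)%:R) ^+ 2 <= K * (gap n + gap n.+1).
Proof.
have [c [N [c0 Hc]]] := sqn_lower; exists (2 / c), N.
split=> [|n y hn hy]; first by rewrite divr_ge0 // ltW.
have g1 := dev_le_gap n.+1 y hy; have g2 := first_gap n (tower n.+1 y).
have g3 := first_gap n (first n.+1); have g4 := first_gap n.+1 (tower n.+2 y).
have hcs := cos2Dsin2 (2 * pi * (alpha * (ret n.+2 y)%:R)).
have hd := dnint_le_cos (alpha * (ret n.+2 y)%:R).
have := Hc n.+2 (tower n.+2 y) (leq_trans hn (leqW (leqnSn n))).
rewrite mulrAC ler_pdivlMr // => hq.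
move: g1 g2 g3 g4 hcs hd hq; rewrite /dev /sqn.
move: (mean1 n.+2 _) (mean2 n.+2 _) (mean1 n.+1 (first _)) (mean2 n.+1 (first _)).
move: (mean1 n.+1 _) (mean2 n.+1 _) (mean1 n _) (mean2 n _) (cos _) (sin _) (dnint _ ^+ 2).
move=> k1 k2 u1 u2 co si dd x y' v1 v2 g1 g2 g3 g4 hcs hd hq.
have sq4 (p q r t : R) : (p + q - r - t) ^+ 2 <= 4 * (p ^+ 2 + q ^+ 2 + r ^+ 2 + t ^+ 2).
  have := sqr_ge0 (p - q); have := sqr_ge0 (p + r); have := sqr_ge0 (p + t).
  have := sqr_ge0 (q + r); have := sqr_ge0 (q + t); have := sqr_ge0 (r - t); nra.
have t1 := sq4 (co * x + si * y' - k1) (k1 - u1) (v1 - u1) (x - v1).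
have t2 := sq4 (- si * x + co * y' - k2) (k2 - u2) (v2 - u2) (y' - v2).
have t3 : 2 * (1 - co) * (x ^+ 2 + y' ^+ 2) <= 8 * (gap n + gap n.+1).
  have -> : 2 * (1 - co) * (x ^+ 2 + y' ^+ 2) = (co * x + si * y' - x) ^+ 2 +
      (- si * x + co * y' - y') ^+ 2.
    transitivity (((co ^+ 2 + si ^+ 2) + 1 - 2 * co) * (x ^+ 2 + y' ^+ 2)); last by ring.
    by rewrite hcs; ring.
  have e1 : co * x + si * y' - x = co * x + si * y' - k1 + (k1 - u1) - (v1 - u1) - (x - v1).
    by ring.
  have e2 : - si * x + co * y' - y' =
      - si * x + co * y' - k2 + (k2 - u2) - (v2 - u2) - (y' - v2) by ring.
  rewrite -e1 in t1; rewrite -e2 in t2; lra.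
have t4 : 2 * (2 * dd) * c <= 2 * (1 - co) * (x ^+ 2 + y' ^+ 2).
  apply: (@le_trans _ _ (2 * (1 - co) * c)); first by rewrite ler_pM2r // ler_pM2l.
  by rewrite ler_wpM2l // mulr_ge0 //; have := sqr_ge0 si; nra.
lra.
Qed.

(** A single base is invariant under [T^-h], so its mean is both unchanged and multiplied by
    [lambda^-h]; being nonzero, it forces [lambda^h = 1]. *)
Lemma single_tower n (k : 'I_(C n)) : C n = 1%N -> 0 < sqn n k -> d n = 0.
Proof.
move=> C1 s0.
have kE (k' : 'I_(C n)) : k' = k.
  by apply: val_inj => /=; have := ltn_ord k; have := ltn_ord k'; lia.
have back z : B n k z -> B n k (iter (h n k) Ti z).
  move=> hz; have hk := h_gt0 S n k.
  have hk' : ((h n k).-1 < h n k)%N by rewrite prednK.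
  have [t1 t2] := tower_below S n k z _ hk' hz.
  have eT : T (iter (h n k) Ti z) = iter (h n k).-1 Ti z.
    by rewrite -{1}(prednK hk) /= sTiK.
  suff /ret0_mem : ret n (iter (h n k) Ti z) = 0%N by rewrite (kE (tower _ _)).
  apply/eqP; rewrite -leqn0 leqNgt; apply/negP => hpos.
  have [] := ret_T S _ _ hpos; rewrite eT t2 => _ e2.
  by have := ret_lt S n (iter (h n k) Ti z); rewrite (kE (tower _ _)); lia.
have BE : Tinvj X T (h n k) (B n k) = B n k.
  have iterK q z : iter q Ti (iter q T z) = z.
    by elim: q z => // q IH z; rewrite iterSr /= sTK IH.
  apply/seteqP; split => x /= hx; first by rewrite -(iterK (h n k) x); exact: back.
  have hm := tower_mem S n (iter (h n k) T x); rewrite (kE (tower _ _)) in hm.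
  have hl := ret_lt S n (iter (h n k) T x); rewrite (kE (tower _ _)) in hl.
  have := tower_below S n k _ _ hl (back _ hm).
  rewrite -iterD addnC iterD iterK iterK => -[_ e].
  have [_ e'] := mem_tower S n k x hx.
  by move: hm; rewrite -e e'.
have mB := bmeasurable_sB S n k.
have [] := Int_Tinvj (h n k) _ mB; rewrite BE => e1 e2.
have {}e1 : mean1 n k = co (h n k) * mean1 n k + si (h n k) * mean2 n k.
  by rewrite {1}/mean1 e1 /mean1 /mean2 mulrDl !mulrA.
have {}e2 : mean2 n k = - si (h n k) * mean1 n k + co (h n k) * mean2 n k.
  by rewrite {1}/mean2 e2 /mean1 /mean2 mulrDl !mulrA.
have hcs := cos2Dsin2 (2 * pi * (alpha * (h n k)%:R)).
have hd := dnint_le_cos (alpha * (h n k)%:R).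
have dk : dnint (alpha * (h n k)%:R) = 0.
  apply/eqP; rewrite -sqrf_eq0 eq_le sqr_ge0 andbT.
  have z0 : (1 - co (h n k)) * sqn n k = 0.
    rewrite /sqn; move: e1 e2; move: (cos _) (sin _) (mean1 n k) (mean2 n k) => c s x y e1 e2.
    transitivity (x * (x - (c * x + s * y)) + y * (y - (- s * x + c * y))); first by ring.
    by rewrite -e1 -e2 !subrr !mulr0 addr0.
  move: z0 => /eqP; rewrite mulf_eq0 (gt_eqF s0) orbF => /eqP z0.
  by move: hd; rewrite z0 pmulr_rle0.
apply/eqP; rewrite eq_le hdist_ge0 andbT; apply: hdist_le => // k'.
by rewrite (kE k') dk.
Qed.

Lemma hdist_zero_after n m : d n = 0 -> (n <= m)%N -> d m = 0.
Proof.
move=> d0 /subnK <-; elim: (m - n)%N => // i IH; rewrite addSn.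
by apply/eqP; rewrite eq_le hdist_ge0 andbT; have := hdistS_le S alpha (i + n); rewrite IH mulr0.
Qed.

(** The second conclusion records the alternative met in the proof, for reuse in the continuous
    case. *)
Lemma hdist_sq_summable : (exists K, forall N, \sum_(0 <= n < N) d n ^+ 2 <= K) /\
  ((exists n0, forall n, (n0 <= n)%N -> d n = 0) \/
   (exists n0, forall n, (n0 <= n)%N -> (1 < C n.+1)%N)).
Proof.
have split_sum (u : nat -> R) M N : (forall n, 0 <= u n) ->
    \sum_(0 <= n < N) u n <= \sum_(0 <= n < M) u n + \sum_(0 <= i < N) u (i + M)%N.
  move=> u0; have -> : \sum_(0 <= i < N) u (i + M)%N = \sum_(M <= n < M + N) u n.
    by have := @big_addn R 0 +%R 0 (M + N) M xpredT u; rewrite add0n addKn => ->.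
  rewrite -big_cat_nat ?leq_addr //= [X in _ <= X](@big_cat_nat _ _ _ N) ?leq_addl //=.
  by rewrite lerDl sumr_ge0.
have [c [N1 [c0 Hc]]] := sqn_lower.
have [[n [hn Cn]]|Hmany] := pselect (exists n, (N1 <= n)%N /\ C n = 1%N).
  have d0 := single_tower n (first n) Cn (lt_le_trans c0 (Hc n (first n) hn)).
  split; last by left; exists n => m; exact: hdist_zero_after.
  exists (\sum_(0 <= i < n) d i ^+ 2) => N.
  apply: le_trans (split_sum (fun i => d i ^+ 2) n N (fun i => sqr_ge0 _)) _.
  rewrite [X in _ + X]big1 ?addr0 // => i _.
  by rewrite (hdist_zero_after n) ?expr0n // leq_addl.
have C2 n : (N1 <= n)%N -> (1 < C n.+1)%N.
  move=> hn; rewrite ltn_neqAle sC_gt0 andbT; apply/eqP => e; apply: Hmany.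
  by exists n.+1; split; [exact: leqW|].
split; last by right; exists N1.
have [K [N2 [K0 HK]]] := visit_gap; set M := maxn N1 N2.
(* [(2 a + b)^2 <= 8 a^2 + 2 b^2], and the middle gap enters both squares: [8 + 2 = 10]. *)
have bound n : (M <= n)%N -> d n.+1 ^+ 2 <=
    10 * K * (gap n + gap n.+1 + gap n.+2).
  rewrite geq_max => /andP[h1 h2].
  pose e m := Num.sqrt (K * (gap m + gap m.+1)).
  have e2 m : e m ^+ 2 = K * (gap m + gap m.+1).
    by rewrite sqr_sqrtr // mulr_ge0 // addr_ge0 ?gap_ge0.
  have he m y : (N2 <= m)%N -> ret m.+1 y = 0%N -> dnint (alpha * (ret m.+2 y)%:R) <= e m.
    move=> hm hy; rewrite -(@ler_pXn2r _ 2) ?nnegrE ?dnint_ge0 ?sqrtr_ge0 // e2.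
    exact: HK.
  have := hdist_le_visits S alpha n.+1 (e n) (e n.+1) (C2 n.+1 (leqW h1))
    (sqrtr_ge0 _) (sqrtr_ge0 _) (fun y _ => he n y h2) (fun y _ => he n.+1 y (leqW h2)).
  rewrite -(@ler_pXn2r _ 2) ?nnegrE ?hdist_ge0 //; last first.
    by rewrite addr_ge0 ?mulr_ge0 ?sqrtr_ge0.
  move=> hd; apply: le_trans hd _.
  have := sqr_ge0 (2 * e n - e n.+1); have := e2 n; have := e2 n.+1.
  have := mulr_ge0 K0 (gap_ge0 n); have := mulr_ge0 K0 (gap_ge0 n.+1).
  have := mulr_ge0 K0 (gap_ge0 n.+2); nra.
set E := L%:R ^+ 3 * (Int (fun x => f1 x ^+ 2) setT + Int (fun x => f2 x ^+ 2) setT).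
have shiftgap p N : \sum_(0 <= i < N) gap (i + p)%N <= E.
  apply: le_trans (sum_gap (p + N)).
  have -> : \sum_(0 <= i < N) gap (i + p)%N = \sum_(p <= n < p + N) gap n.
    by have := @big_addn R 0 +%R 0 (p + N) p xpredT gap; rewrite add0n addKn => ->.
  rewrite [X in _ <= X](@big_cat_nat _ _ _ p) ?leq_addr //= lerDr sumr_ge0 // => i _.
  exact: gap_ge0.
exists (\sum_(0 <= i < M.+1) d i ^+ 2 + 10 * K * (E + E + E)) => N.
apply: le_trans (split_sum (fun i => d i ^+ 2) M.+1 N (fun i => sqr_ge0 _)) _.
rewrite lerD2l; apply: (@le_trans _ _ (\sum_(0 <= i < N)
    10 * K * (gap (i + M) + gap (i + M.+1) + gap (i + M.+2)))).
  by apply: ler_sum => i _; rewrite !addnS; apply: bound; exact: leq_addl.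
rewrite -mulr_sumr ler_wpM2l ?mulr_ge0 // !big_split /=.
by apply: lerD; [apply: lerD|]; exact: shiftgap.
Qed.

End Energy.

(** * Summability is necessary for continuous eigenvalues *)

Section ContinuousNecessity.
Context {R : realType} {X : ptopologicalType} (S : kr_system X) (alpha : R).
Variables f1 f2 : X -> R.
Hypothesis cf1 : continuous f1.
Hypothesis cf2 : continuous f2.
Hypothesis f_ne0 : exists x, f1 x != 0 \/ f2 x != 0.
Hypothesis f_eigen : forall x,
  f1 (sT S x) = cos (2 * pi * alpha) * f1 x - sin (2 * pi * alpha) * f2 x /\
  f2 (sT S x) = sin (2 * pi * alpha) * f1 x + cos (2 * pi * alpha) * f2 x.
Local Notation T := (sT S).
Local Notation Ti := (sTi S).
Local Notation C := (sC S).
Local Notation B := (sB S).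
Local Notation h := (sh S).
Local Notation tower := (tower S).
Local Notation ret := (ret S).
Local Notation pos := (pos S).
Local Notation first := (first S).
Local Notation d := (hdist S alpha).
Local Notation co j := (cos (2 * pi * (alpha * j%:R))).
Local Notation si j := (sin (2 * pi * (alpha * j%:R))).

(** By (KR4) some atom around the common point [u] of the roofs is small enough. As [u] is also in
    the next roof, this atom is the first base of its level, and by (KR6) it contains the next
    roof. *)
Lemma continuous_near_roof (f : X -> R) (e : R) : continuous f -> 0 < e ->
  exists M, forall z z', ret M z = 0%N -> ret M z' = 0%N -> `|f z - f z'| <= 2 * e.
Proof.
move=> cf e0; have [u [hu _]] := ret_ne0_ex S.
have oU : open [set x | `|f u - f x| < e].
  rewrite openE => x /= hx.
  have e1 : 0 < e - `|f u - f x| by rewrite subr_gt0.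
  have /cvgrPdist_lt /(_ _ e1) := cf x; apply: filterS => y /= hy.
  have -> : f u - f y = (f u - f x) + (f x - f y) by ring.
  by apply: le_lt_trans (ler_normD _ _) _; lra.
have [_ _ _ _ [_ H _ _ _]] := sys_KR _ S.
have Uu : [set x | `|f u - f x| < e] u by rewrite /= subrr normr0.
have [n [A [[k [j [hj ->]]] Au AU]]] := H _ u oU Uu.
have [t1 t2] := tower_uniq S _ _ _ _ hj Au; rewrite hu in t2.
have [t3 _] := ret_first S n u (hu n.+1).
have near z : ret n.+1 z = 0%N -> `|f u - f z| < e.
  move=> hz; have [z1 z2] := ret_first S n z hz; apply: AU.
  by rewrite /Tinvj /= -t2 -t1 t3 -z1; exact: ret0_mem.
exists n.+1 => z z' /near h1 /near h2.
have -> : f z - f z' = (f u - f z') - (f u - f z) by ring.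
by apply: le_trans (ler_normB _ _) _; lra.
Qed.

Lemma sqmod_T x : f1 (T x) ^+ 2 + f2 (T x) ^+ 2 = f1 x ^+ 2 + f2 x ^+ 2.
Proof.
have [-> ->] := f_eigen x; have := cos2Dsin2 (2 * pi * alpha).
move: (cos _) (sin _) (f1 x) (f2 x) => c s u v hcs.
by rewrite -[RHS]mul1r -hcs; ring.
Qed.

(** The modulus is invariant and continuous, and orbits are dense. *)
Lemma sqmod_const : exists2 r, 0 < r & forall x, f1 x ^+ 2 + f2 x ^+ 2 = r.
Proof.
have [x0 hx0] := f_ne0; exists (f1 x0 ^+ 2 + f2 x0 ^+ 2).
  rewrite lt_neqAle addr_ge0 ?sqr_ge0 // andbT eq_sym paddr_eq0 ?sqr_ge0 // !sqrf_eq0.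
  by case: hx0 => /negbTE ->; rewrite ?andbF.
have orbT n : f1 (iter n T x0) ^+ 2 + f2 (iter n T x0) ^+ 2 = f1 x0 ^+ 2 + f2 x0 ^+ 2.
  by elim: n => // n IH; rewrite iterS sqmod_T.
have orbTi n : f1 (iter n Ti x0) ^+ 2 + f2 (iter n Ti x0) ^+ 2 = f1 x0 ^+ 2 + f2 x0 ^+ 2.
  by elim: n => // n IH; rewrite iterS -sqmod_T sTiK.
have [_ _ hmin] := sys_minimal _ S.
move=> y; apply: contrapT => /eqP hy.
have : closure (two_sided_orbit X T Ti x0) y by rewrite hmin.
have cg : continuous (fun x => f1 x ^+ 2 + f2 x ^+ 2).
  by move=> x; apply: cvgD; rewrite expr2; apply: cvgM; (exact: cf1 || exact: cf2).
have pos_gap : 0 < `|f1 y ^+ 2 + f2 y ^+ 2 - (f1 x0 ^+ 2 + f2 x0 ^+ 2)|.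
  by rewrite normr_gt0 subr_eq0.
have /cvgrPdist_lt /(_ _ pos_gap) hnb := cg y.
by move=> /(_ _ hnb) [z [[n [->|->]] /=]]; rewrite ?orbT ?orbTi ltxx.
Qed.

Lemma eigen_iter j x : f1 (iter j T x) = co j * f1 x - si j * f2 x /\
  f2 (iter j T x) = si j * f1 x + co j * f2 x.
Proof.
elim: j => [|j [IH1 IH2]]; first by rewrite !mulr0 cos0 sin0 !mul1r !mul0r subr0 add0r.
rewrite iterS; have [-> ->] := f_eigen (iter j T x); rewrite IH1 IH2.
have -> : 2 * pi * (alpha * j.+1%:R) = 2 * pi * (alpha * j%:R) + 2 * pi * alpha.
  by rewrite -natr1; ring.
by rewrite cosD sinD; split; ring.
Qed.

Lemma return_small : exists M, forall z j, ret M z = 0%N -> ret M (iter j T z) = 0%N ->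
  dnint (alpha * j%:R) <= 8^-1.
Proof.
have [r r0 hr] := sqmod_const.
(* This gives [2 (1 - cos) r <= 8 e^2 = r / 32], so [1 - cos <= 1/64], enough for a distance of at
   most 1/8. *)
set e := Num.sqrt r / 16; have e0 : 0 < e by rewrite divr_gt0 // sqrtr_gt0.
have e2 : e ^+ 2 = r / 256 by rewrite expr_div_n sqr_sqrtr ?ltW //; congr (_ / _); ring.
have [M1 H1] := continuous_near_roof f1 e cf1 e0.
have [M2 H2] := continuous_near_roof f2 e cf2 e0.
exists (maxn M1 M2) => z j hz hzj.
have r0le M x : (M <= maxn M1 M2)%N -> ret (maxn M1 M2) x = 0%N -> ret M x = 0%N.
  by move=> hM hx; have := ret_le S M _ x hM; rewrite hx leqn0 => /eqP.
have k1 := H1 _ _ (r0le _ _ (leq_maxl _ _) hzj) (r0le _ _ (leq_maxl _ _) hz).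
have k2 := H2 _ _ (r0le _ _ (leq_maxr _ _) hzj) (r0le _ _ (leq_maxr _ _) hz).
have sq y : `|y| <= 2 * e -> y ^+ 2 <= 4 * e ^+ 2.
  move=> hy; rewrite -(real_normK (num_real y)).
  have -> : 4 * e ^+ 2 = (2 * e) ^+ 2 by ring.
  by rewrite ler_pXn2r // nnegrE ?normr_ge0 // mulr_ge0 // ltW.
move: (sq _ k1) (sq _ k2); have [-> ->] := eigen_iter j z => s1 s2.
have hd := dnint_le_cos (alpha * j%:R).
have hcs := cos2Dsin2 (2 * pi * (alpha * j%:R)); have hz' := hr z.
have e3 : 2 * (1 - co j) * r <= 8 * e ^+ 2.
  rewrite -hz'; move: (cos _) (sin _) (f1 z) (f2 z) hcs s1 s2 => c s u v hcs s1 s2.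
  have -> : 2 * (1 - c) * (u ^+ 2 + v ^+ 2) = (c * u - s * v - u) ^+ 2 + (s * u + c * v - v) ^+ 2.
    transitivity (((c ^+ 2 + s ^+ 2) + 1 - 2 * c) * (u ^+ 2 + v ^+ 2)); last by ring.
    by rewrite hcs; ring.
  by lra.
have e4 : (1 - co j) <= 64^-1.
  by rewrite e2 in e3; rewrite -(ler_pM2r r0); lra.
rewrite -(@ler_pXn2r _ 2) ?nnegrE ?dnint_ge0 ?invr_ge0 //.
by move: hd e4; move: (cos _) (dnint _ ^+ 2) => c dd; lra.
Qed.

(* Every second level is left free (the point sits on top of a tower there), so
   that visits at the other levels can be prescribed independently. *)
Lemma chain_return (y : nat -> X) N I z :
  (forall i, tower (N + i.*2).+2 (y i) = first (N + i.*2).+2) ->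
  (forall i, ret (N + i.*2).+1 (y i) = 0%N) ->
  B (N + I.*2) (first (N + I.*2)) z ->
  ret N (iter (\sum_(0 <= i < I) ret (N + i.*2).+2 (y i))%N Ti z) = 0%N.
Proof.
move=> y1 y2; elim: I z => [|I IH] z.
  by rewrite big_geq // addn0 => /mem_tower[].
rewrite doubleS !addnS => hz; rewrite big_nat_recr //= iterD; apply: IH.
have hl := ret_lt S (N + I.*2).+2 (y I); rewrite y1 in hl.
have [t1 t2] := tower_below S _ _ _ _ hl hz.
have [t3 t4] := tower_coarsen S _ _ (y I) (etrans t1 (esym (y1 I))) t2.
rewrite y2 in t4; have [t5 t6] := ret_first S _ _ t4.
by rewrite -t5; exact: ret0_mem.
Qed.

(** Each partial sum is congruent to [alpha] times a return time, hence within 1/8 of an integer,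
    and each step is at most 1/4. Starting from 0, sums of constant sign cannot pass 1/2 towards
    another integer. *)
Lemma signed_sum (y : nat -> X) N M (s : R) : (forall z j, ret M z = 0%N ->
    ret M (iter j T z) = 0%N -> dnint (alpha * j%:R) <= 8^-1) -> (M <= N)%N ->
  (forall i, tower (N + i.*2).+2 (y i) = first (N + i.*2).+2) ->
  (forall i, ret (N + i.*2).+1 (y i) = 0%N) ->
  s = 1 \/ s = -1 ->
  (forall i, 0 <= s * sres (alpha * (ret (N + i.*2).+2 (y i))%:R)) ->
  forall I, \sum_(0 <= i < I) s * sres (alpha * (ret (N + i.*2).+2 (y i))%:R) <= 8^-1.
Proof.
move=> hM MN y1 y2 hs spos.
pose J I := (\sum_(0 <= i < I) ret (N + i.*2).+2 (y i))%N.
have dJ I : dnint (alpha * (J I)%:R) <= 8^-1.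
  have [z hz] := sB_ex S (N + I.*2) (first (N + I.*2)).
  have rle x : ret N x = 0%N -> ret M x = 0%N.
    by move=> hx; have := ret_le S M N x MN; rewrite hx leqn0 => /eqP.
  apply: (hM (iter (J I) Ti z)); apply: rle; first exact: chain_return.
  rewrite iter_sTiK; have [_ hr] := mem_tower S _ _ _ hz.
  by have := ret_le S N (N + I.*2) z (leq_addr _ _); rewrite hr leqn0 => /eqP.
pose st I := \sum_(0 <= i < I) sres (alpha * (ret (N + i.*2).+2 (y i))%:R).
have stJ I : exists z : int, st I = alpha * (J I)%:R + z%:~R.
  elim: I => [|I [z IH]]; first by exists 0; rewrite /st /J !big_geq // mulr0 addr0.
  exists (z - nearint (alpha * (ret (N + I.*2).+2 (y I))%:R)).
  rewrite /st /J !big_nat_recr //= -/(st I) -/(J I) IH natrD intrB /sres; ring.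
have dst I : dnint (s * st I) <= 8^-1.
  have [z hz] := stJ I; have e : dnint (st I) <= 8^-1 by rewrite hz dnintDint dJ.
  by case: hs => ->; rewrite ?mul1r ?mulN1r ?dnintN.
move=> I; rewrite -mulr_sumr -/(st I).
elim: I => [|I IH]; first by rewrite /st big_geq // mulr0 invr_ge0.
have e1 : st I.+1 = st I + sres (alpha * (ret (N + I.*2).+2 (y I))%:R) by exact: big_nat_recr.
have e2 : J I.+1 = (J I + ret (N + I.*2).+2 (y I))%N by exact: big_nat_recr.
have st0 : 0 <= s * st I.+1 by rewrite /st mulr_sumr sumr_ge0.
have h1 : s * sres (alpha * (ret (N + I.*2).+2 (y I))%:R) <= 4^-1.
  apply: le_trans (ler_norm _) _.
  have -> : `|s * sres (alpha * (ret (N + I.*2).+2 (y I))%:R)| =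
      dnint (alpha * (ret (N + I.*2).+2 (y I))%:R).
    by rewrite normrM norm_sres; case: hs => ->; rewrite ?normrN normr1 mul1r.
  have -> : alpha * (ret (N + I.*2).+2 (y I))%:R = alpha * (J I.+1)%:R - alpha * (J I)%:R.
    by rewrite e2 natrD; ring.
  by apply: le_trans (dnintB _ _) _; have := dJ I; have := dJ I.+1; lra.
have h2 : s * st I.+1 <= 2^-1 by rewrite e1 mulrDr; lra.
by have := dst I.+1; rewrite dnint_small ger0_norm.
Qed.

(** Inside one tower a visit is determined by its depth, so only finitely many are compared. *)
Lemma max_visit n : exists y, [/\ tower n.+1 y = first n.+1, ret n y = 0%N &
  forall y', tower n.+1 y' = first n.+1 -> ret n y' = 0%N ->
    dnint (alpha * (ret n.+1 y')%:R) <= dnint (alpha * (ret n.+1 y)%:R)].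
Proof.
pose P (j : 'I_(h n.+1 (first n.+1))) := ret n (pos n.+1 (first n.+1) j) == 0%N.
have locP y : tower n.+1 y = first n.+1 -> (ret n.+1 y < h n.+1 (first n.+1))%N.
  by move=> <-; exact: ret_lt.
have PE y (hy : tower n.+1 y = first n.+1) : P (Ordinal (locP y hy)) = (ret n y == 0%N).
  have [p1 p2] := tower_pos S _ _ _ (locP y hy).
  by rewrite /P /=; have [_ ->] := tower_coarsen S n _ y (etrans p1 (esym hy)) p2.
have [y0 [t0 _ r0]] := visit_ex S n (first n.+1) (first n).
have P0 : P (Ordinal (locP y0 t0)) by rewrite PE r0.
case: (arg_maxP (fun j : 'I_(h n.+1 (first n.+1)) => dnint (alpha * j%:R)) P0) => j Pj jmax.
have [p1 p2] := tower_pos S _ _ _ (ltn_ord j).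
exists (pos n.+1 (first n.+1) j); split => //; first exact/eqP.
by move=> y' t' r'; rewrite p2; apply: (jmax (Ordinal (locP y' t'))); rewrite PE r'.
Qed.

Lemma hdist_summable n0 : (forall n, (n0 <= n)%N -> (1 < C n.+1)%N) ->
  exists K, forall N, \sum_(0 <= n < N) d n <= K.
Proof.
move=> hC; have [M hM] := return_small.
have /choice [y hy] := max_visit.
pose e n := dnint (alpha * (ret n.+1 (y n))%:R).
have half N I : (M <= N)%N -> \sum_(0 <= i < I) e (N + i.*2).+1 <= 4^-1.
  move=> MN.
  (* Keep the worst visits whose residue has the sign of [s] and replace the others by the top
     floor, with residue zero. The two signs together give [1/8 + 1/8]. *)
  pose yt (s : R) i : X := let n := (N + i.*2).+1 in
    if 0 <= s * sres (alpha * (ret n.+1 (y n))%:R) then y n else pos n.+1 (first n.+1) 0.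
  have top i : [/\ tower (N + i.*2).+2 (pos (N + i.*2).+2 (first (N + i.*2).+2) 0) = first (N + i.*2).+2,
      ret (N + i.*2).+2 (pos (N + i.*2).+2 (first (N + i.*2).+2) 0) = 0%N &
      ret (N + i.*2).+1 (pos (N + i.*2).+2 (first (N + i.*2).+2) 0) = 0%N].
    have [p1 p2] := tower_pos S _ _ _ (h_gt0 S _ (first (N + i.*2).+2)).
    by split => //; have [] := ret_first S _ _ p2.
  have yt1 s i : tower (N + i.*2).+2 (yt s i) = first (N + i.*2).+2.
    by rewrite /yt; case: ifP => _; [have [] := hy (N + i.*2).+1|have [] := top i].
  have yt2 s i : ret (N + i.*2).+1 (yt s i) = 0%N.
    by rewrite /yt; case: ifP => _; [have [] := hy (N + i.*2).+1|have [] := top i].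
  have s00 : sres (0 : R) = 0.
    by apply/eqP; rewrite -normr_eq0 norm_sres dnint0.
  have yt3 s i : 0 <= s * sres (alpha * (ret (N + i.*2).+2 (yt s i))%:R).
    rewrite /yt; case: ifP => [//|_]; have [_ -> _] := top i.
    by rewrite mulr0 s00 mulr0.
  have sp := signed_sum (yt 1) N M 1 hM MN (yt1 1) (yt2 1) (or_introl erefl) (yt3 1) I.
  have sm := signed_sum (yt (-1)) N M (-1) hM MN (yt1 (-1)) (yt2 (-1)) (or_intror erefl)
    (yt3 (-1)) I.
  apply: (@le_trans _ _ (8^-1 + 8^-1)); last by lra.
  apply: le_trans (lerD sp sm); rewrite -big_split /=; apply: ler_sum => i _.
  have p := yt3 1 i; have q := yt3 (-1) i.
  rewrite /e -norm_sres; set w := sres (alpha * (ret (N + i.*2).+2 (y (N + i.*2).+1))%:R).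
  have [w0|w0] := lerP 0 w.
    have e1 : yt 1 i = y (N + i.*2).+1 by rewrite /yt mul1r w0.
    by rewrite e1 -/w mul1r (ger0_norm w0) lerDl.
  have e1 : yt (-1) i = y (N + i.*2).+1 by rewrite /yt mulN1r oppr_ge0 (ltW w0).
  by rewrite e1 -/w mulN1r (ltr0_norm w0) lerDr.
have sumdouble (u : nat -> R) I : \sum_(0 <= i < I.*2) u i =
    \sum_(0 <= i < I) u i.*2 + \sum_(0 <= i < I) u i.*2.+1.
  elim: I => [|I IH]; first by rewrite !big_geq // addr0.
  by rewrite doubleS !big_nat_recr //= IH; ring.
have e0 n : 0 <= e n by exact: dnint_ge0.
(* The two parities of levels are summed separately, since [chain_return] leaves every second level
   free. *)
have esum p I : (M <= p)%N -> \sum_(0 <= i < I) e (p + i).+1 <= 2^-1.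
  move=> Mp; apply: (@le_trans _ _ (\sum_(0 <= i < I.*2) e (p + i).+1)).
    rewrite [X in _ <= X](@big_cat_nat _ _ _ I) //= -?addnn ?leq_addr //.
    by rewrite lerDl sumr_ge0.
  rewrite sumdouble; have h1 := half p I Mp; have h2 := half p.+1 I (leqW Mp).
  have h3 : \sum_(0 <= i < I) e (p + i.*2.+1).+1 = \sum_(0 <= i < I) e (p.+1 + i.*2).+1.
    by apply: eq_bigr => i _; rewrite addnS addSn.
  by rewrite h3; lra.
pose p := maxn n0 M.
have dle i : d (p + i).+1 <= 2 * e (p + i).+1 + e (p + i).+2.
  apply: hdist_le_visits => //.
  - by apply: hC; apply: leqW; rewrite (leq_trans (leq_maxl n0 M)) // leq_addr.
  - by move=> y' t' r'; have [_ _ H] := hy (p + i).+1; exact: H.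
  - by move=> y' t' r'; have [_ _ H] := hy (p + i).+2; exact: H.
exists (\sum_(0 <= n < p.+1) d n + (2 * 2^-1 + 2^-1)) => N.
apply: (@le_trans _ _ (\sum_(0 <= n < p.+1 + N) d n)).
  rewrite [X in _ <= X](@big_cat_nat _ _ _ N) ?leq_addl //= lerDl sumr_ge0 // => i _.
  exact: hdist_ge0.
rewrite (@big_cat_nat _ _ _ p.+1) ?leq_addr //= lerD2l.
have -> : \sum_(p.+1 <= n < p.+1 + N) d n = \sum_(0 <= i < N) d (p + i).+1.
  have := @big_addn R 0 +%R 0 (p.+1 + N) p.+1 xpredT d; rewrite add0n addKn => ->.
  by apply: eq_bigr => i _; rewrite addnS addnC.
apply: (@le_trans _ _ (\sum_(0 <= i < N) (2 * e (p + i).+1 + e (p + i).+2))).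
  by apply: ler_sum => i _; exact: dle.
rewrite big_split /= -mulr_sumr; apply: lerD.
  by rewrite ler_pM2l // esum // leq_maxr.
have h3 : \sum_(0 <= i < N) e (p + i).+2 = \sum_(0 <= i < N) e (p.+1 + i).+1.
  by apply: eq_bigr => i _; rewrite addSn.
by rewrite h3 esum // leqW // leq_maxr.
Qed.

End ContinuousNecessity.

(** * Continuous eigenvalues are eigenvalues with respect to [mu] *)

Section ContinuousIsMeasurable.
Context {R : realType} {X : ptopologicalType} (S : kr_system X).
Variables (mu : probability (borelX X) R) (alpha : R).
Local Notation T := (sT S).

Lemma continuous_bmeasurable (f : X -> R) : continuous f ->
  measurable_fun [set: borelX X] (f : borelX X -> R).
Proof.
move=> cf; apply: (measurability _ (RGenOInfty.measurableE R)) => //.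
move=> _ [_ [a ->] <-]; rewrite setTI; apply: open_bmeasurable.
by apply: open_comp => [x _|]; [exact: cf|exact: interval_open].
Qed.

(** A constant positive modulus gives square integrability and nonvanishing. The alternative of
    [hdist_sq_summable] thus becomes available for continuous eigenvalues. *)
Lemma continuous_L2_eigenvalue : continuous_eigenvalue R X T alpha ->
  L2_eigenvalue R X T mu alpha.
Proof.
move=> [f1 [f2 [cf1 cf2 f_ne0 f_eigen]]].
have [r r0 hr] := sqmod_const S alpha f1 f2 cf1 cf2 f_ne0 f_eigen.
exists f1, f2; split.
- exact: continuous_bmeasurable.
- exact: continuous_bmeasurable.
- rewrite (eq_integral (fun=> r%:E)) => [|x _]; last by rewrite hr.
  rewrite integral_cst // lte_mul_pinfty ?lee_fin ?ltW //.
  by apply: le_lt_trans (probability_le1 mu measurableT) _; rewrite ltry.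
- move=> hz; apply: (ae_not_False mu); move: hz; apply: ae_imply => x [e1 e2].
  by have := hr x; rewrite e1 e2 expr0n addr0 => e; rewrite -e ltxx in r0.
- by exists set0; split => // x /= H; apply: H; exact: f_eigen.
Qed.

End ContinuousIsMeasurable.

(** * From the series of the statement to bounded sums of [hdist] *)

Section Summability.
Context {R : realType} {X : ptopologicalType} (S : kr_system X) (alpha : R).
Local Notation T := (sT S).
Local Notation C := (sC S).
Local Notation B := (sB S).
Local Notation h := (sh S).
Local Notation d := (hdist S alpha).

(** [g] will be the square or the identity. Starting at 0 instead of 2 adds only two terms. *)
Lemma summable_hdistP (u : nat -> R) (g : R -> R) : (forall t, 0 <= t -> 0 <= g t) ->
  (forall n, u n = g (dnintv (alpha *: (Pmat X T C B h R n *m H1 C h R)))) ->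
  ((\sum_(2 <= n <oo) (u n)%:E < +oo)%E <->
   exists K, forall N, \sum_(0 <= n < N) g (d n) <= K).
Proof.
move=> g0 hu; have gd n : 0 <= g (d n) by apply: g0; exact: hdist_ge0.
have u0 n : 0 <= u n by rewrite hu; apply: g0; exact: bigmax_ge_id.
have uE N : \sum_(2 <= n < N) u n = \sum_(2 <= n < N) g (d n).
  rewrite !big_nat; apply: eq_bigr => n /andP[hn _]; rewrite hu dnintv_Pmat //.
  exact: leq_trans hn.
rewrite nneseries_lt_pinftyP //; split => -[K hK].
  exists (\sum_(0 <= n < 2) g (d n) + K) => N.
  apply: (@le_trans _ _ (\sum_(0 <= n < 2 + N) g (d n))).
    by rewrite [X in _ <= X](@big_cat_nat _ _ _ N) ?leq_addl //= lerDl sumr_ge0.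
  by rewrite (@big_cat_nat _ _ _ 2) //= lerD2l -uE.
exists K => N; rewrite uE; apply: le_trans (hK (2 + N)%N).
rewrite [X in _ <= X](@big_cat_nat _ _ _ 2) //=.
(* The maximum covers [N < 2], where the first sum is empty. *)
rewrite [X in _ <= _ + X](_ : _ = \sum_(2 <= n < N) g (d n) + \sum_(maxn 2 N <= n < 2 + N) g (d n)).
  by rewrite addrCA lerDl addr_ge0 // sumr_ge0.
have [hN|/ltnW hN] := leqP 2 N.
  by rewrite (@big_cat_nat _ _ _ N) ?leq_addl.
by rewrite [in RHS]big_geq // add0r.
Qed.

End Summability.

(** * The two equivalences put together *)

Theorem theorem1 (R : realType) (X : ptopologicalType) (T Ti : X -> X)
  (C : nat -> nat) (B : forall n, 'I_(C n) -> set X)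
  (h : forall n, 'I_(C n) -> nat)
  (mu : probability (borelX X) R) (alpha : R) :
  minimal_cantor_system X T Ti ->
  KR_LR_sequence X T C B h ->
  T_invariant R X T mu ->
  (L2_eigenvalue R X T mu alpha <->
     (\sum_(2 <= n <oo)
        ((dnintv (alpha *: (Pmat X T C B h R n *m H1 C h R))) ^+ 2)%:E < +oo)%E) /\
  (continuous_eigenvalue R X T alpha <->
     (\sum_(2 <= n <oo)
        (dnintv (alpha *: (Pmat X T C B h R n *m H1 C h R)))%:E < +oo)%E).
Proof.
move=> hmin hKR inv.
pose S := KRSystem X T Ti C B h hmin hKR.
have P1 := summable_hdistP S alpha _ (fun t => t ^+ 2) (fun t _ => sqr_ge0 t) (fun=> erefl).
have P2 := summable_hdistP S alpha _ id (fun t t0 => t0) (fun=> erefl).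
have nec : L2_eigenvalue R X T mu alpha ->
    (exists K, forall N, \sum_(0 <= n < N) hdist S alpha n ^+ 2 <= K) /\
    ((exists n0, forall n, (n0 <= n)%N -> hdist S alpha n = 0) \/
     (exists n0, forall n, (n0 <= n)%N -> (1 < C n.+1)%N)).
  by move=> [f1 [f2 [*]]]; apply: (hdist_sq_summable S mu alpha inv f1 f2).
split.
  apply: (iff_trans _ (iff_sym P1)); split; first by move/nec => [].
  by move=> [K hK]; exact: (L2_eigenvalue_of_summable S mu alpha inv K).
apply: (iff_trans _ (iff_sym P2)); split; last first.
  by move=> [K hK]; exact: (continuous_eigenvalue_of_summable S alpha K).
(* Either [hdist] vanishes from some level on and the sum is finite, or all large levels have at
   least two towers and the argument with signed residues applies. *)
move=> hc; have [_ [[n0 hn0]|[n0 hn0]]] := nec (continuous_L2_eigenvalue S mu alpha hc).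
  exists (\sum_(0 <= n < n0) hdist S alpha n) => N.
  apply: (@le_trans _ _ (\sum_(0 <= n < n0 + N) hdist S alpha n)).
    rewrite [X in _ <= X](@big_cat_nat _ _ _ N) ?leq_addl //= lerDl sumr_ge0 // => i _.
    exact: hdist_ge0.
  rewrite (@big_cat_nat _ _ _ n0) ?leq_addr //= [X in _ + X]big_nat [X in _ + X]big1 ?addr0 //.
  by move=> i /andP[hi _]; exact: hn0.
have [f1 [f2 [cf1 cf2 f_ne0 f_eigen]]] := hc.
exact: (hdist_summable S alpha f1 f2 cf1 cf2 f_ne0 f_eigen n0 hn0).
Qed.
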